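(* Let $1<\alpha<2$ and $\tfrac12\le r\le 1$ be fixed, and let $\beta$, $k$, $\rho^{(a,b)}$, $\lambda_n$, $G_n^{(a,b)}$, $q_N$ and $q$ be as defined in the context. There exists a constant $C>0$, independent of $f$ and $N$, such that for every $f\in L^2_{\rho^{(\beta-1,\alpha-\beta-1)}}(0,1)$ and every integer $N\ge 0$, $$\|q-q_N\|_{\rho^{(-(\alpha-\beta),-\beta)}}\ \le\ \frac{1}{|\lambda_N|}\,\|f\|_{\rho^{(\beta-1,\alpha-\beta-1)}}\ \le\ C\,(N+1)^{-\alpha+1}\,\|f\|_{\rho^{(\beta-1,\alpha-\beta-1)}}.$$
   Context: All functions are real-valued on $(0,1)$. Weights: $\rho^{(a,b)}(x):=(1-x)^a x^b$. For $\omega>0$ on $(0,1)$, $L^2_\omega(0,1)$ is the space of $f$ with $\|f\|_\omega:=\big(\int_0^1\omega(x) f(x)^2\,dx\big)^{1/2}<\infty$. Given $1<\alpha<2$ and $r$, the number $\beta$ with $\alpha-1\le\beta\le1$ is determined by $r=\dfrac{\sin(\pi\beta)}{\sin(\pi(\alpha-\beta))+\sin(\pi\beta)}$. Put $k(x):=(1-x)^{\alpha-\beta-1}x^{\beta-1}$. Shifted Jacobi polynomials (for $a,b>-1$): $G_n^{(a,b)}(x):=P_n^{(a,b)}(2x-1)$, where $P_n^{(a,b)}(y)=2^{-n}\sum_{m=0}^n\binom{n+a}{m}\binom{n+b}{n-m}(y-1)^{n-m}(y+1)^m$ is the usual Jacobi polynomial. Their norms are $$|\|G_n^{(a,b)}|\|:=\Big(\int_0^1(1-x)^a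 x^b\,G_n^{(a,b)}(x)^2\,dx\Big)^{1/2}=\Big(\tfrac{1}{2n+a+b+1}\tfrac{\Gamma(n+a+1)\Gamma(n+b+1)}{\Gamma(n+1)\Gamma(n+a+b+1)}\Big)^{1/2}.$$ Constants: $\lambda_n:=\dfrac{\sin(\pi\alpha)}{\sin(\pi(\alpha-\beta))+\sin(\pi\beta)}\dfrac{\Gamma(n+\alpha)}{n!}$ for $n\ge0$, and $\lambda_{-1}:=-(1-r)\Gamma(\alpha)\dfrac{\sin(\pi\alpha)}{\sin(\pi(\alpha-\beta))}$, which equals $-\Gamma(\alpha)\dfrac{\sin(\pi\alpha)}{\sin(\pi(\alpha-\beta))+\sin(\pi\beta)}$ (the latter expression is used when $r=1$). For $f\in L^2_{\rho^{(\beta-1,\alpha-\beta-1)}}(0,1)$ set $f_i:=\int_0^1\rho^{(\beta-1,\alpha-\beta-1)}(x)f(x)G_i^{(\beta-1,\alpha-\beta-1)}(x)\,dx$ for $i\ge0$, $c_i:=\dfrac{f_{i+1}}{\lambda_i\,|\|G_{i+1}^{(\beta-1,\alpha-\beta-1)}|\|^2}$ for $i\ge-1$, and $$q_N(x):=c_{-1}\,x\,k(x)+\rho^{(\alpha-\beta,\beta)}(x)\sum_{i=0}^{N-1}c_i\,G_i^{(\alpha-\beta,\beta)}(x).$$ The function $q$ is defined by $q-c_{-1}xk:=\lim_{N\to\infty}(q_N-c_{-1}xk)$, the limit being taken in $L^2_{\rho^{(-(\alpha-\beta),-\beta)}}(0,1)$ (where it exists). *)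

(* Defs.v *)
From HB Require Import structures.
From mathcomp Require Import all_boot all_order all_algebra.
From mathcomp Require Import all_classical all_reals all_analysis.

Set Implicit Arguments.
Unset Strict Implicit.
Unset Printing Implicit Defensive.

Import Order.TTheory GRing.Theory Num.Theory.
Import numFieldNormedType.Exports.

Local Open Scope classical_set_scope.
Local Open Scope ring_scope.

(* Functions on (0,1) are represented by functions on [R] whose values outside
   [`]0, 1[] are never used. *)

Definition rho (R : realType) (a b x : R) : R := (1 - x) `^ a * x `^ b.

(* Extended-real valued, so that an infinite norm is not collapsed to 0. *)
Definition wnorm (R : realType) (w f : R -> R) : \bar R :=
  ((\int[@lebesgue_measure R]_(x in `]0%R, 1%R[) (w x * f x ^+ 2)%:E) `^ 2^-1)%E.

Definition L2w (R : realType) (w : R -> R) : set (R -> R) :=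
  [set f | measurable_fun (`]0, 1[ : set R) f /\ (wnorm w f < +oo)%E].

Definition L2w_cvg (R : realType) (w : R -> R) (g : nat -> R -> R) (l : R -> R)
    : Prop :=
  [/\ forall n, L2w w (g n), L2w w l
    & wnorm w (fun x => l x - g n x) @[n --> \oo] --> 0%E].

Definition Gamma (R : realType) (s : R) : R :=
  \int[@lebesgue_measure R]_(t in `]0, +oo[) (t `^ (s - 1) * expR (- t)).

Definition gbinom (R : realType) (z : R) (m : nat) : R :=
  (\prod_(i < m) (z - i%:R)) / m`!%:R.

Definition jacobiP (R : realType) (a b : R) (n : nat) (y : R) : R :=
  2 ^- n * \sum_(m < n.+1)
    gbinom (n%:R + a) m * gbinom (n%:R + b) (n - m) *
    (y - 1) ^+ (n - m) * (y + 1) ^+ m.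

Definition jacobiG (R : realType) (a b : R) (n : nat) (x : R) : R :=
  jacobiP a b n (2 * x - 1).

(* |||G_n^(a,b)|||^2; the integrand is continuous and integrable for a, b > -1. *)
Definition jacobiG_norm2 (R : realType) (a b : R) (n : nat) : R :=
  \int[@lebesgue_measure R]_(x in `]0, 1[) (rho a b x * jacobiG a b n x ^+ 2).

Definition jacobiG_norm (R : realType) (a b : R) (n : nat) : R :=
  Num.sqrt (jacobiG_norm2 a b n).

Definition kfun (R : realType) (alpha beta x : R) : R :=
  (1 - x) `^ (alpha - beta - 1) * x `^ (beta - 1).

Definition lambda (R : realType) (alpha beta : R) (n : nat) : R :=
  sin (pi * alpha) / (sin (pi * (alpha - beta)) + sin (pi * beta)) *
  (Gamma (n%:R + alpha) / n`!%:R).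

(* lambda_(-1); for r = 1 one has sin (pi * (alpha - beta)) = 0 and the general
   expression is the indeterminate form 0 / 0. *)
Definition lambda_m1 (R : realType) (alpha beta r : R) : R :=
  if r == 1 then
    - Gamma alpha *
      (sin (pi * alpha) / (sin (pi * (alpha - beta)) + sin (pi * beta)))
  else
    - (1 - r) * Gamma alpha * (sin (pi * alpha) / sin (pi * (alpha - beta))).

Definition fcoef (R : realType) (alpha beta : R) (f : R -> R) (i : nat) : R :=
  \int[@lebesgue_measure R]_(x in `]0, 1[)
    (rho (beta - 1) (alpha - beta - 1) x * f x *
     jacobiG (beta - 1) (alpha - beta - 1) i x).

Definition ccoef (R : realType) (alpha beta : R) (f : R -> R) (i : nat) : R :=
  fcoef alpha beta f i.+1 /
  (lambda alpha beta i *
   jacobiG_norm (beta - 1) (alpha - beta - 1) i.+1 ^+ 2).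

(* c_(-1) *)
Definition ccoef_m1 (R : realType) (alpha beta r : R) (f : R -> R) : R :=
  fcoef alpha beta f 0 /
  (lambda_m1 alpha beta r *
   jacobiG_norm (beta - 1) (alpha - beta - 1) 0 ^+ 2).

Definition singular_part (R : realType) (alpha beta r : R) (f : R -> R) (x : R)
    : R :=
  ccoef_m1 alpha beta r f * x * kfun alpha beta x.

Definition qN (R : realType) (alpha beta r : R) (f : R -> R) (N : nat) (x : R)
    : R :=
  singular_part alpha beta r f x +
  rho (alpha - beta) beta x *
  \sum_(i < N) ccoef alpha beta f i * jacobiG (alpha - beta) beta i x.

(* [q] is (a representative of) the function defined by
   q - c_(-1) x k = lim_N (q_N - c_(-1) x k) in the weighted L^2 space; [q] and
   [q_N] themselves need not belong to that space. *)
Definition is_q (R : realType) (alpha beta r : R) (f q : R -> R) : Prop :=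
  L2w_cvg (rho (- (alpha - beta)) (- beta))
    (fun N x => qN alpha beta r f N x - singular_part alpha beta r f x)
    (fun x => q x - singular_part alpha beta r f x).

(* Main.v *)
(* Write a = alpha - beta and b = beta; r > 0 forces b < 1, so all weights below
   have exponents > -1. The shifted Jacobi polynomials satisfy
     d/dx G_(n+1)^(a,b) = (n + a + b + 2) G_n^(a+1,b+1),
     d/dx (rho^(a+1,b+1) G_n^(a+1,b+1)) = - (n + 1) rho^(a,b) G_(n+1)^(a,b),
   so one integration by parts gives both the orthogonality (by induction on the
   degree) and, after x -> 1 - x, the ratio
     |||G_i^(a,b)|||^2 / |||G_(i+1)^(b-1,a-1)|||^2 = (i + 1) / (i + alpha) <= 1;
   no Beta integral is evaluated. With Bessel's inequality, the tail of the series
   from N on is at most ||f||^2 / lambda_N^2, since |lambda_i| is nondecreasing by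
   Gamma(s + 1) = s Gamma(s). The limit q exists because the weighted L^2 space is
   complete, and lambda_(n+1) / lambda_n = 1 + (alpha - 1) / (n + 1)
   >= ((n + 2) / (n + 1))^(alpha - 1) gives the rate. *)
Require Import Defs.
From HB Require Import structures.
From mathcomp Require Import all_boot all_order all_algebra.
From mathcomp Require Import all_classical all_reals all_analysis.
From mathcomp Require Import measurable_realfun ring lra.

Set Implicit Arguments.
Unset Strict Implicit.
Unset Printing Implicit Defensive.

Import Order.TTheory GRing.Theory Num.Theory.
Import numFieldNormedType.Exports.

Local Open Scope classical_set_scope.
Local Open Scope ring_scope.

(** * Exhaustion by segments *)

(** The fundamental theorem holds on each segment, where everything is finite, and monotone
    convergence carries it to [D]. Keeping the nonnegative [f] and [g] on opposite sides avoids any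
    subtraction of infinities, so the identity also makes sense for infinite integrals. *)
Lemma ge0_exhaustion_FTC2 (R : realType) (D : set R) (s t : nat -> R)
    (f g F : R -> R) (l m : R) :
  (forall n, s n < t n) ->
  nondecreasing_seq (fun n => `[s n, t n]%classic) ->
  D = \bigcup_n `[s n, t n]%classic ->
  (forall x, D x -> {for x, continuous f}) ->
  (forall x, D x -> {for x, continuous g}) ->
  (forall x, D x -> 0 <= f x) -> (forall x, D x -> 0 <= g x) ->
  (forall x, D x -> is_derive x 1 F (f x - g x)) ->
  F (s n) @[n --> \oo] --> l -> F (t n) @[n --> \oo] --> m ->
  (\int[@lebesgue_measure R]_(x in D) (f x)%:E + l%:E =
   \int[@lebesgue_measure R]_(x in D) (g x)%:E + m%:E)%E.
Proof.
move=> st nd DE cf cg f0 g0 dF Fs Ft.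
have DnD n : `[s n, t n]%classic `<=` D.
  by rewrite DE; apply: (bigcup_sup (F := fun n => `[s n, t n]%classic)).
have cw (h : R -> R) : (forall x, D x -> {for x, continuous h}) ->
    forall n, {within `[s n, t n], continuous h}.
  move=> ch n; apply: continuous_in_subspaceT => x.
  by rewrite inE => /DnD /ch.
have mw (h : R -> R) : (forall x, D x -> {for x, continuous h}) ->
    forall n, measurable_fun (`[s n, t n] : set R) (EFin \o h).
  move=> ch n; apply/measurable_EFinP.
  by apply: subspace_continuous_measurable_fun => //; exact: cw.
have iw (h : R -> R) : (forall x, D x -> {for x, continuous h}) ->
    forall n, (@lebesgue_measure R).-integrable `[s n, t n] (EFin \o h).
  move=> ch n; apply: continuous_compact_integrable; last exact: cw.
  exact: segment_compact.
have lim (h : R -> R) : (forall x, D x -> {for x, continuous h}) ->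
    (forall x, D x -> 0 <= h x) ->
    (\int[@lebesgue_measure R]_(x in `[s n, t n]) (h x)%:E)%E @[n --> \oo]
      --> (\int[@lebesgue_measure R]_(x in D) (h x)%:E)%E.
  move=> ch h0; rewrite DE.
  have := @ge0_nondecreasing_set_cvg_integral _ (measurableTypeR R) R
    (fun n => `[s n, t n]%classic)
    (EFin \o h) (@lebesgue_measure R) nd; apply => //.
  - exact: mw.
  - by move=> n x /DnD Dx; rewrite lee_fin h0.
have key n : (\int[@lebesgue_measure R]_(x in `[s n, t n]) (f x)%:E + (F (s n))%:E =
   \int[@lebesgue_measure R]_(x in `[s n, t n]) (g x)%:E + (F (t n))%:E)%E.
  have Fd x : D x -> derivable F x 1 by move=> /dF [].
  have sD : D (s n) by apply: (DnD n); rewrite /= in_itv/= lexx ltW.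
  have tD : D (t n) by apply: (DnD n); rewrite /= in_itv/= lexx ltW.
  have Fc x : D x -> {for x, continuous F}.
    by move=> /Fd /derivable1_diffP /differentiable_continuous.
  have : (\int[@lebesgue_measure R]_(x in `[s n, t n]) (f x - g x)%:E =
      (F (t n))%:E - (F (s n))%:E)%E.
    apply: (@continuous_FTC2 _ (fun x => f x - g x)) => //.
    - apply: cw => x Dx; apply: continuousB; [exact: cf|exact: cg].
    - split.
      + move=> x xst; apply: Fd; apply: (DnD n) => /=.
        exact: subset_itv_oo_cc.
      + exact/cvg_at_right_filter/Fc.
      + exact/cvg_at_left_filter/Fc.
    - move=> x xst; rewrite derive1E.
      have /dF [_ ->//] : D x by apply: (DnD n); exact: subset_itv_oo_cc.
  under eq_integral do rewrite EFinB.
  rewrite integralB//=; [|exact: iw|exact: iw].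
  have fin (h : R -> R) : (forall x, D x -> {for x, continuous h}) ->
      (\int[@lebesgue_measure R]_(x in `[s n, t n]) (h x)%:E)%E \is a fin_num.
    by move=> ch; apply: integrable_fin_num => //; exact: iw.
  rewrite -(fineK (fin _ cf)) -(fineK (fin _ cg)) => -[] E.
  by congr EFin; lra.
have c1 : ((\int[@lebesgue_measure R]_(x in `[s n, t n]) (f x)%:E + (F (s n))%:E)%E
    @[n --> \oo] --> (\int[@lebesgue_measure R]_(x in D) (f x)%:E + l%:E)%E).
  apply: cvgeD; first exact: fin_num_adde_defl.
    exact: lim.
  by apply: cvg_EFin => //; exact: nearW.
have c2 : ((\int[@lebesgue_measure R]_(x in `[s n, t n]) (g x)%:E + (F (t n))%:E)%E
    @[n --> \oo] --> (\int[@lebesgue_measure R]_(x in D) (g x)%:E + m%:E)%E).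
  apply: cvgeD; first exact: fin_num_adde_defl.
    exact: lim.
  by apply: cvg_EFin => //; exact: nearW.
move: c1; under eq_fun do rewrite key.
by move=> c1; exact: (cvg_unique _ c1 c2).
Qed.

(** * Completeness of weighted L2 spaces *)

Lemma is_cvgn_sum_sqr (R : realType) (u : nat -> R) (B : R) :
  (forall n, \sum_(0 <= i < n) 2 ^+ i * (u i.+1 - u i) ^+ 2 <= B) -> cvgn u.
Proof.
move=> uB.
(* With z = 2^i |y| this is z <= z^2 + 1, divided by 2^i. *)
have ler i : `|u i.+1 - u i| <= 2 ^+ i * (u i.+1 - u i) ^+ 2 + 2 ^- i.
  set y := _ - _; have e0 : 0 < 2 ^+ i :> R by rewrite exprn_gt0.
  have -> : 2 ^+ i * y ^+ 2 + 2 ^- i = ((2 ^+ i * `|y|) ^+ 2 + 1) / 2 ^+ i.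
    by rewrite exprMn real_normK ?num_real//; field; rewrite gt_eqF.
  rewrite ler_pdivlMr//; nra.
suff : cvgn (series (telescope u)).
  rewrite telescopeK => cv.
  have -> : u = (fun n => (u n - u 0%N) + u 0%N).
    by apply/funext => n; rewrite subrK.
  by apply: is_cvgD => //; exact: is_cvg_cst.
apply: normed_cvg; apply: nondecreasing_is_cvgn.
  apply/nondecreasing_seqP => n.
  by rewrite -subr_ge0 seriesSB /= normr_ge0.
(* [B] bounds the weighted squares and 2 the geometric series. *)
exists (B + 2) => _ [n _ <-]; rewrite /series/=.
have geo : \sum_(0 <= i < n) 2 ^- i <= 2 :> R.
  suff -> : \sum_(0 <= i < n) 2 ^- i = 2 - 2 * 2 ^- n :> R.
    by rewrite gerBl mulr_ge0// invr_ge0 exprn_ge0.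
  elim: n => [|n IH]; first by rewrite big_geq// expr0 invr1; ring.
  rewrite big_nat_recr//= IH exprS invfM.
  by field; rewrite expf_neq0.
apply: (le_trans _ (lerD (uB n) geo)).
by rewrite -big_split/=; apply: ler_sum => i _; exact: ler.
Qed.

Section weighted_L2_complete.
Context d (T : measurableType d) (R : realType).
Variables (mu : {measure set T -> \bar R}) (D : set T) (w : T -> R).
Hypotheses (mD : measurable D) (mw : measurable_fun D w).
Hypothesis w0 : forall x, D x -> 0 < w x.

Let msq (f g : T -> R) : measurable_fun D f -> measurable_fun D g ->
  measurable_fun D (fun x => (w x * (f x - g x) ^+ 2)%:E).
Proof.
move=> mf mg; apply/measurable_EFinP; apply: measurable_funM => //.
by apply: measurable_funX; exact: measurable_funB.
Qed.

Let sq0 (f g : T -> R) x : D x -> (0 <= (w x * (f x - g x) ^+ 2)%:E)%E.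
Proof. by move=> Dx; rewrite lee_fin mulr_ge0// ?sqr_ge0// ltW// w0. Qed.

(* [|y| <= 2^n y^2 + 2^-n] turns summability of the weighted squares into absolute
   convergence of the increments. *)
Lemma weighted_L2_rapidly_cvg (S : nat -> T -> R) :
  (forall n, measurable_fun D (S n)) ->
  (forall n, (\int[mu]_(x in D) (w x * (S n.+1 x - S n x) ^+ 2)%:E
              <= (2 ^- n / (2 ^ n.+1)%:R)%:E)%E) ->
  {ae mu, forall x, D x -> cvgn (S ^~ x)}.
Proof.
move=> mS hS.
pose h i x := ((2 ^+ i)%:E * (w x * (S i.+1 x - S i x) ^+ 2)%:E)%E.
have h0 i x : D x -> (0 <= h i x)%E.
  by move=> Dx; rewrite mule_ge0 ?sq0// lee_fin exprn_ge0.
have mh i : measurable_fun D (h i).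
  by apply: measurable_funeM; apply: msq.
pose g x := (\sum_(0 <= i <oo) h i x)%E.
have mg : measurable_fun D g.
  by apply: (@ge0_emeasurable_sum _ _ _ D h xpredT) => [k x Dx _|k _]; [exact: h0|exact: mh].
have g0 x : D x -> (0 <= g x)%E by move=> Dx; apply: nneseries_ge0 => i _ _; exact: h0.
have ig : mu.-integrable D g.
  apply/integrableP; split => //.
  (* The factor 2^i cancels the 2^-i of the hypothesis, so the i-th term has integral at most
     2^-(i+1) and [g] has integral at most 1. Hence [g] is finite almost everywhere. *)
  apply: (@le_lt_trans _ _ 1%:E); last exact: ltry.
  rewrite (eq_integral g); last first.
    by move=> x; rewrite inE => Dx; rewrite gee0_abs// g0.
  rewrite integral_nneseries//.
  apply: (le_trans _ (epsilon_trick0 xpredT ler01)).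
  apply: lee_nneseries => [i _ _|i _]; first exact: integral_ge0 (h0 i).
  rewrite /h ge0_integralZl_EFin ?exprn_ge0//; [|by move=> x; exact: sq0|exact: msq].
  apply: (@le_trans _ _ ((2 ^+ i)%:E * (2 ^- i / (2 ^ i.+1)%:R)%:E)%E).
    by apply: lee_wpmul2l; [rewrite lee_fin exprn_ge0|exact: hS].
  by rewrite -EFinM lee_fin mulrA divff ?expf_neq0.
apply: filterS (integrable_ae mD ig) => x gx Dx.
have := gx Dx; move=> /fineK gE.
(* The terms of [g x] carry the factor [w x], which is positive and is divided out. *)
apply: (@is_cvgn_sum_sqr _ _ (fine (g x) / w x)) => n.
rewrite ler_pdivlMr ?w0// -lee_fin gE.
apply: (le_trans _ (@nneseries_lim_ge _ _ xpredT 0 n _)); last first.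
  by move=> i _ _; exact: h0.
rewrite mulr_suml -sumEFin; apply: lee_sum => i _.
by rewrite /h -EFinM lee_fin -mulrA [_ * w x]mulrC.
Qed.

(** A rapidly Cauchy subsequence converges almost everywhere, and Fatou's lemma along it carries the
    Cauchy bound [t n] to the limit unchanged. *)
Lemma weighted_L2_complete (S : nat -> T -> R) (t : nat -> R) :
  (forall n, measurable_fun D (S n)) -> t n @[n --> \oo] --> 0 ->
  (forall n m, (n <= m)%N ->
    (\int[mu]_(x in D) (w x * (S m x - S n x) ^+ 2)%:E <= (t n)%:E)%E) ->
  exists2 l : T -> R, measurable_fun D l & forall n,
    (\int[mu]_(x in D) (w x * (l x - S n x) ^+ 2)%:E <= (t n)%:E)%E.
Proof.
move=> mS t0 St.
have /choice[k Hk] : forall i, exists k, (i <= k)%N /\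
    forall m, (k <= m)%N -> t m <= 2 ^- i / (2 ^ i.+1)%:R.
  move=> i; have e0 : 0 < 2 ^- i / (2 ^ i.+1)%:R :> R.
    by rewrite divr_gt0 ?invr_gt0 ?exprn_gt0// ltr0n expn_gt0.
  move/cvgrPdist_le : t0 => /(_ _ e0)[N _ HN].
  exists (maxn i N); split; first exact: leq_maxl.
  move=> m; rewrite geq_max => /andP[_ /HN/=].
  by rewrite sub0r normrN => /(le_trans (ler_norm _)).
have ki i : (i <= k i)%N by have [] := Hk i.
have kt i m : (k i <= m)%N -> t m <= 2 ^- i / (2 ^ i.+1)%:R.
  by have [_] := Hk i; exact.
have cvS : {ae mu, forall x, D x -> cvgn (fun i => S (k i) x)}.
  apply: weighted_L2_rapidly_cvg => // i.
  (* [k] need not be monotone. If it decreases, the two terms are exchanged and the smaller bound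
     belonging to i+1 applies. *)
  have [kk|/ltnW kk] := leqP (k i) (k i.+1).
    by apply: le_trans (St _ _ kk) _; rewrite lee_fin kt.
  under eq_integral do rewrite -sqrrN opprB.
  apply: le_trans (St _ _ kk) _; rewrite lee_fin; apply: le_trans (kt i.+1 _ _) _ => //.
  rewrite -!natrX -!invfM lef_pV2 ?posrE -?natrM ?ltr0n ?muln_gt0 ?expn_gt0//.
  by rewrite ler_nat leq_mul// leq_exp2l.
(* The upper limit exists at every point and is measurable; it is the limit wherever the subsequence
   converges. *)
pose l x := fine (limn_esup (fun i => (S (k i) x)%:E)).
have ml : measurable_fun D l.
  apply: (measurableT_comp (fine_measurable _)) => //.
  apply: measurable_fun_limn_esup => i; apply/measurable_EFinP; exact: mS.
exists l => // n.
(* The shift by [n] ensures k(i+n) >= n, so that the Cauchy bound at [n] applies to every term. *)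
pose F i x := (w x * (S (k (i + n)%N) x - S n x) ^+ 2)%:E.
have F0 i x : D x -> (0 <= F i x)%E by exact: sq0.
have mF i : measurable_fun D (F i) by exact: msq.
apply: (@le_trans _ _ (\int[mu]_(x in D) limn_einf (F ^~ x))%E).
  apply: ae_ge0_le_integral => //.
  - by move=> x; exact: sq0.
  - exact: msq.
  - move=> x Dx; rewrite limn_einf_lim; apply: lime_ge; first exact: is_cvg_einfs.
    apply: nearW => m; apply: le_ereal_inf_tmp => _ [i _ <-]; exact: F0.
  - rewrite (_ : (fun x => _) = (fun x => - limn_esup (fun i => - F i x))%E); last first.
      apply/funext => x; rewrite -limn_einfN; congr limn_einf.
      by apply/funext => i; exact: (esym (oppeK _)).
    apply: measurableT_comp => //; apply: measurable_fun_limn_esup => i.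
    by apply: measurableT_comp.
  apply: filterS cvS => x cx Dx; have {}cx := cx Dx.
  set u := fun i => S (k i) x in cx.
  have lx : l x = limn u.
    rewrite /l (_ : limn_esup _ = (limn u)%:E)//.
    by apply: (cvg_limn_einf_sup _).2; apply: cvg_EFin => //; exact: nearW.
  have cF : F i x @[i --> \oo] --> (w x * (limn u - S n x) ^+ 2)%:E.
    apply: cvg_EFin; first exact: nearW.
    apply: cvgM; first exact: cvg_cst.
    have c1 : u (i + n)%N - S n x @[i --> \oo] --> limn u - S n x.
      apply: cvgB; last exact: cvg_cst.
      have : u i @[i --> \oo] --> limn u by exact: cx.
      by rewrite -(cvg_shiftn n).
    by rewrite expr2; under eq_fun do rewrite /= expr2; exact: cvgM.
  by rewrite lx (cvg_limn_einf_sup cF).1 lexx.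
apply: le_trans (fatou mu mD mF F0) _.
rewrite limn_einf_lim; apply: lime_le; first exact: is_cvg_einfs.
apply: nearW => m; apply: ereal_inf_le; eexists; first by exists m => /=.
by apply: St; apply: leq_trans (ki _); exact: leq_addl.
Qed.

(* Minkowski is replaced by (x + y)^2 <= (1 + e) x^2 + (1 + 1/e) y^2 with e
   arbitrarily small. *)
Lemma weighted_L2_limit_le (f g : T -> R) (h : nat -> T -> R) (t : R) :
  measurable_fun D f -> measurable_fun D g ->
  (forall n, measurable_fun D (h n)) ->
  (forall n, (\int[mu]_(x in D) (w x * (h n x - g x) ^+ 2)%:E <= t%:E)%E) ->
  (forall e, 0 < e -> exists n,
    (\int[mu]_(x in D) (w x * (f x - h n x) ^+ 2)%:E <= e%:E)%E) ->
  (\int[mu]_(x in D) (w x * (f x - g x) ^+ 2)%:E <= t%:E)%E.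
Proof.
move=> mf mg mh ht fh.
have t0 : 0 <= t.
  by rewrite -lee_fin (le_trans _ (ht 0%N))//; apply: integral_ge0 => x; exact: sq0.
apply/lee_addgt0Pr => _/posnumP[eps].
(* With accuracy e^2 for [h n] the bound becomes (1+e) t + (1+1/e) e^2 = t + e t + e^2 + e. Since e
   <= 1 this is at most t + e (t+2), hence at most t + eps. *)
pose e := Num.min 1 (eps%:num / (t + 2)).
have e0 : 0 < e by rewrite lt_min ltr01 divr_gt0// ltr_wpDl.
have e1 : e <= 1 by rewrite ge_min lexx.
have ee : e * (t + 2) <= eps%:num.
  by rewrite -ler_pdivlMr ?ltr_wpDl// ge_min lexx orbT.
have [n hn] := fh _ (exprn_gt0 2 e0).
apply: (@le_trans _ _ ((1 + e)%:E *
    \int[mu]_(x in D) (w x * (h n x - g x) ^+ 2)%:E + (1 + e^-1)%:E *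
    \int[mu]_(x in D) (w x * (f x - h n x) ^+ 2)%:E)%E).
  have ce : 0 <= 1 + e by rewrite addr_ge0// ltW.
  have ce' : 0 <= 1 + e^-1 by rewrite addr_ge0// invr_ge0 ltW.
  rewrite -!ge0_integralZl_EFin//; try (by move=> x; exact: sq0); try exact: msq.
  rewrite -ge0_integralD//=; first last.
  - by apply: measurable_funeM; exact: msq.
  - by move=> x Dx; rewrite mule_ge0 ?sq0.
  - by apply: measurable_funeM; exact: msq.
  - by move=> x Dx; rewrite mule_ge0 ?sq0.
  apply: ge0_le_integral => //.
  - by move=> x; exact: sq0.
  - exact: msq.
  - by apply: emeasurable_funD; apply: measurable_funeM; exact: msq.
  move=> x Dx; rewrite -!EFinM -EFinD lee_fin.
  rewrite ![(1 + _) * (w x * _)]mulrCA -mulrDr.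
  apply: ler_wpM2l; first exact/ltW/w0.
  have -> : f x - g x = (h n x - g x) + (f x - h n x) by ring.
  move: (h n x - g x) (f x - h n x) => u v.
  rewrite -subr_ge0.
  have -> : (1 + e) * u ^+ 2 + (1 + e^-1) * v ^+ 2 - (u + v) ^+ 2 =
      e^-1 * (e * u - v) ^+ 2 by field; rewrite gt_eqF.
  by rewrite mulr_ge0 ?sqr_ge0// invr_ge0 ltW.
apply: (@le_trans _ _ (((1 + e) * t)%:E + ((1 + e^-1) * e ^+ 2)%:E)%E).
  by apply: leeD; rewrite EFinM; apply: lee_wpmul2l; rewrite ?lee_fin ?addr_ge0 ?invr_ge0// ltW.
rewrite -!EFinD lee_fin.
have -> : (1 + e^-1) * e ^+ 2 = e ^+ 2 + e by field; rewrite gt_eqF.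
by nra.
Qed.

End weighted_L2_complete.

(** * Shifted Jacobi polynomials *)

(** The shifted Jacobi polynomial as a formal polynomial: for y = 2x-1 one has y-1 = 2(x-1) and y+1
    = 2x, and the powers of 2 cancel the factor 2^-n. *)
Definition jacobi_poly (R : realType) (a b : R) (n : nat) : {poly R} :=
  \sum_(m < n.+1) (gbinom (n%:R + a) m * gbinom (n%:R + b) (n - m)) *:
    (('X - 1) ^+ (n - m) * 'X^m).

Lemma jacobiGE (R : realType) (a b : R) n :
  jacobiG a b n = horner (jacobi_poly a b n).
Proof.
apply/funext => x; rewrite /jacobiG /jacobiP /jacobi_poly horner_sum mulr_sumr.
apply: eq_bigr => i _.
move: (gbinom _ i) (gbinom _ (n - i)) => g h.
rewrite hornerZ hornerM horner_exp hornerXn hornerD hornerN hornerX.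
have -> : (1 : {poly R}).[x] = 1 by exact: hornerC.
have -> : 2 * x - 1 - 1 = 2 * (x - 1) by ring.
have -> : 2 * x - 1 + 1 = 2 * x by ring.
have -> : 2 ^- n = 2 ^- (n - i) * 2 ^- i :> R.
  by rewrite -invfM -exprD subnK// -ltnS.
have n2 : (2 : R) != 0 by rewrite pnatr_eq0.
have := expf_neq0 (n - i) n2; have := expf_neq0 i n2.
rewrite !exprMn; move: (2 ^+ (n - i)) (2 ^+ i) ((x - 1) ^+ _) (x ^+ _) => s t u v s0 t0.
by field; rewrite s0 t0.
Qed.

Lemma jacobi_poly0 (R : realType) (a b : R) : jacobi_poly a b 0 = 1.
Proof.
rewrite /jacobi_poly big_ord1 /gbinom !big_ord0 fact0 !divr1 mulr1 scale1r.
by rewrite !expr0 mulr1.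
Qed.

Lemma gbinomS (R : realType) (z : R) m :
  m.+1%:R * gbinom z m.+1 = (z - m%:R) * gbinom z m.
Proof.
rewrite /gbinom big_ord_recr/= factS natrM.
by field; rewrite pnatr_eq0 -lt0n fact_gt0 addrC natr1 pnatr_eq0.
Qed.

Lemma deriv_Xsub1nXn (R : realType) k m :
  (('X - 1) ^+ k * 'X^m : {poly R})^`() =
  k%:R *: (('X - 1) ^+ k.-1 * 'X^m) + m%:R *: (('X - 1) ^+ k * 'X^(m.-1)).
Proof.
have d1 : ('X - 1 : {poly R})^`() = 1.
  have d0 : (1 : {poly R})^`() = 0 by exact: derivC.
  by rewrite derivB derivX d0 subr0.
by rewrite derivM deriv_exp d1 derivXn mul1r mulrnAl mulrnAr !scaler_nat.
Qed.

(** The coefficient of (X-1)^(n-m) X^m receives contributions from the indices m and m+1. By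
    [gbinomS] they combine to the factor (A-m) + (B-(n-m)) = n+a+b+2. *)
Lemma deriv_jacobi_poly (R : realType) (a b : R) n :
  (jacobi_poly a b n.+1)^`() =
  (n%:R + a + b + 2) *: jacobi_poly (a + 1) (b + 1) n.
Proof.
rewrite /jacobi_poly linear_sum /= scaler_sumr.
have -> : n%:R + (a + 1) = n.+1%:R + a by rewrite -natr1; ring.
have -> : n%:R + (b + 1) = n.+1%:R + b by rewrite -natr1; ring.
set A := n.+1%:R + a; set B := n.+1%:R + b.
under eq_bigr do rewrite derivZ deriv_Xsub1nXn scalerDr !scalerA.
rewrite big_split/= big_ord_recr/= subnn mulr0 scale0r addr0.
rewrite [X in _ + X]big_ord_recl/= mulr0 scale0r add0r -big_split/=.
apply: eq_bigr => -[m]/=; rewrite ltnS => mn _.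
rewrite /bump/= add1n subSS subSn//= scalerA -scalerDl.
congr (_ *: _).
have := gbinomS A m; have := gbinomS B (n - m); rewrite /A /B -!natr1 natrB//.
move: (gbinom _ _) (gbinom _ m) (gbinom _ _) (gbinom _ (n - m)) => B' A1 A' B1 HB HA.
transitivity (A1 * ((n%:R - m%:R + 1) * A') + (m%:R + 1) * B' * B1); first by ring.
by rewrite HB HA; ring.
Qed.

(** This is the derivative formula for rho^(a+1,b+1) G_n^(a+1,b+1), divided by rho^(a,b) so as to
    become a polynomial identity. *)
Lemma jacobi_poly_rodrigues (R : realType) (a b : R) n :
  let q := jacobi_poly (a + 1) (b + 1) n in
  'X * (1 - 'X) * q^`() + ((b + 1) *: (1 - 'X) - (a + 1) *: 'X) * q =
  - n.+1%:R *: jacobi_poly a b n.+1.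
Proof.
rewrite /= /jacobi_poly linear_sum /=.
have -> : n%:R + (a + 1) = n.+1%:R + a by rewrite -natr1; ring.
have -> : n%:R + (b + 1) = n.+1%:R + b by rewrite -natr1; ring.
set A := n.+1%:R + a; set B := n.+1%:R + b.
rewrite !mulr_sumr -big_split/= scaler_sumr.
(* Each index on the left contributes to two neighbouring products (X-1)^(n+1-m) X^m. On the right,
   n+1 is split as (n+1-m) + m to match. *)
transitivity (\sum_(m < n.+1) - ((n.+1 - m)%:R * (gbinom A m * gbinom B (n.+1 - m)) *:
     (('X - 1) ^+ (n.+1 - m) * 'X^m : {poly R})) +
  \sum_(m < n.+1) - ((m.+1)%:R * (gbinom A m.+1 * gbinom B (n - m)) *:
     (('X - 1) ^+ (n - m) * 'X^(m.+1) : {poly R}))).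
  rewrite -big_split/=; apply: eq_bigr => -[m]/=; rewrite ltnS => mn _.
  rewrite derivZ deriv_Xsub1nXn.
  have -> : m.+1%:R * (gbinom A m.+1 * gbinom B (n - m)) =
     (a + 1 + (n - m)%:R) * (gbinom A m * gbinom B (n - m)).
    by rewrite mulrA gbinomS /A natrB// -natr1; ring.
  have -> : (n.+1 - m)%:R * (gbinom A m * gbinom B (n.+1 - m)) =
     (b + 1 + m%:R) * (gbinom A m * gbinom B (n - m)).
    by rewrite subSn// mulrCA gbinomS /B natrB// -natr1; ring.
  move: (gbinom A m * _) => g; rewrite subSn//.
  (* The exponent 0 is treated apart, since its predecessor is again 0; the scalar factor then
     vanishes. *)
  have e1 : (n - m)%:R *: ('X * (1 - 'X) * ('X - 1) ^+ (n - m).-1) =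
     - ((n - m)%:R *: ('X * ('X - 1) ^+ (n - m))) :> {poly R}.
    case: (n - m)%N => [|k]; first by rewrite !scale0r oppr0.
    by rewrite /= exprS -scalerN; congr (_ *: _); ring.
  have e2 : m%:R *: ('X * (1 - 'X) * 'X^(m.-1)) = - (m%:R *: (('X - 1) * 'X^m)) :> {poly R}.
    case: m {mn g e1} => [|k]; first by rewrite !scale0r oppr0.
    by rewrite /= exprS -scalerN; congr (_ *: _); ring.
  move: e1 e2; rewrite -!mul_polyC !exprS.
  move: ('X ^+ m) ('X ^+ m.-1) (('X - 1) ^+ (n - m)) (('X - 1) ^+ (n - m).-1) => u u' v v' e1 e2.
  rewrite !polyCM !polyCD.
  transitivity (g%:P * ((n - m)%:R%:P * ('X * (1 - 'X) * v')) * u +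
    g%:P * v * (m%:R%:P * ('X * (1 - 'X) * u')) +
    ((b%:P + 1%:P) * (1 - 'X) - (a%:P + 1%:P) * 'X) * (g%:P * (v * u))); first by ring.
  rewrite e1 e2; ring.
under [RHS]eq_bigr => m _.
  rewrite scalerA -[- n.+1%:R](_ : - ((n.+1 - m)%:R + m%:R) = _); last first.
    by rewrite natrB ?subrK// -ltnS.
  rewrite mulNr scaleNr mulrDl scalerDl opprD.
over.
rewrite big_split/= [X in _ = X + _]big_ord_recr/= subnn mul0r scale0r oppr0 addr0.
congr (_ + _).
by rewrite [RHS]big_ord_recl/= mul0r scale0r oppr0 add0r.
Qed.

(** * The weights on the unit interval *)

Lemma ge0_unit_FTC2 (R : realType) (f g F : R -> R) (l m : R) :
  (forall x : R, 0 < x < 1 -> {for x, continuous f}) ->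
  (forall x : R, 0 < x < 1 -> {for x, continuous g}) ->
  (forall x : R, 0 < x < 1 -> 0 <= f x) -> (forall x : R, 0 < x < 1 -> 0 <= g x) ->
  (forall x : R, 0 < x < 1 -> is_derive x 1 F (f x - g x)) ->
  F x @[x --> 0^'+] --> l -> F x @[x --> 1^'-] --> m ->
  (\int[@lebesgue_measure R]_(x in `]0%R, 1%R[) (f x)%:E + l%:E =
   \int[@lebesgue_measure R]_(x in `]0%R, 1%R[) (g x)%:E + m%:E)%E.
Proof.
move=> cf cg f0 g0 dF F0 F1.
(* The shift by 3 gives s n < 1/2, hence a nondegenerate segment, already for n = 0. *)
pose s (n : nat) : R := n.+3%:R^-1.
have s0 n : 0 < s n by rewrite invr_gt0.
have s1 n : s n < 1 - s n.
  by rewrite ltrBrDr -mulr2n -mulr_natr ltr_pdivrMl// mulr1 ltr_nat.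
have sS n k : (n <= k)%N -> s k <= s n by move=> nk; rewrite lef_pV2 ?posrE// ler_nat.
have sto0 : s n @[n --> \oo] --> 0.
  by have := @cvg_harmonic R; rewrite -(cvg_shiftn 2)/=; under eq_fun do rewrite addn2.
have in01 x : (`]0, 1[%classic : set R) x -> 0 < x < 1 by rewrite /= in_itv.
apply: (@ge0_exhaustion_FTC2 R _ s (fun n => 1 - s n) f g F l m) => //;
  try by move=> x /in01; auto.
- apply/nondecreasing_seqP => n; rewrite subsetEset; apply: subset_itv.
    by rewrite bnd_simp sS.
  by rewrite bnd_simp lerB// sS.
- apply/seteqP; split=> [x /in01/andP[x0 x1]|x [n _]]; last first.
    rewrite /= !in_itv/= => /andP[sx xs]; rewrite (lt_le_trans (s0 n))//=.
    by rewrite (le_lt_trans xs)// ltrBlDr ltrDl.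
  have e0 : 0 < Num.min x (1 - x) by rewrite lt_min x0 subr_gt0.
  move/cvgrPdist_le : sto0 => /(_ _ e0)[n _ /(_ n (leqnn n))].
  rewrite /= sub0r normrN gtr0_norm// le_min => /andP[nx n1x].
  by exists n => //=; rewrite in_itv/= nx lerBrDr -lerBrDl.
- by apply: (cvg_at_rightP _ _ _).1 F0 _ _; split.
- apply: (cvg_at_leftP _ _ _).1 F1 _ _; split => [n|].
    by rewrite ltrBlDr ltrDl.
  by rewrite -[X in _ --> X]subr0; apply: cvgB => //; exact: cvg_cst.
Qed.

Lemma is_derive_rho (R : realType) (a b x : R) : 0 < x < 1 ->
  is_derive x 1 (rho (a + 1) (b + 1))
    (rho a b x * ((b + 1) * (1 - x) - (a + 1) * x)).
Proof.
move=> /andP[x0 x1]; have y0 : 0 < 1 - x by rewrite subr_gt0.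
have d1 : is_derive x 1 (fun x : R => (1 - x) `^ (a + 1))
    ((a + 1) * (1 - x) `^ a * (0 - 1)).
  apply: (@is_derive1_comp _ (fun y => y `^ (a + 1)) (fun x => 1 - x)).
  by have := @is_derive1_powR _ (a + 1) _ y0; rewrite addrK.
have d2 : is_derive x 1 (fun x : R => x `^ (b + 1)) ((b + 1) * x `^ b).
  by have := @is_derive1_powR _ (b + 1) _ x0; rewrite addrK.
apply: (is_derive_eq (is_deriveM d1 d2)).
rewrite /GRing.scale/= /rho (powRD (r := a)) ?(gt_eqF y0) ?implybT//.
rewrite (powRD (r := b)) ?(gt_eqF x0) ?implybT// !powRr1 ?ltW//.
ring.
Qed.

Lemma continuous_rho (R : realType) (a b x : R) : 0 < x < 1 ->
  {for x, continuous (rho a b)}.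
Proof.
move=> /(is_derive_rho (a - 1) (b - 1)); rewrite !subrK => -[+ _].
by move=> /derivable1_diffP /differentiable_continuous.
Qed.

Lemma continuous_powRl (R : realType) (p x : R) : 0 < x ->
  {for x, continuous (fun y : R => y `^ p)}.
Proof.
move=> /(is_derive1_powR p)[+ _].
by move=> /derivable1_diffP /differentiable_continuous.
Qed.

Lemma rho_ge0 (R : realType) (a b x : R) : 0 <= rho a b x.
Proof. by rewrite mulr_ge0 ?powR_ge0. Qed.

Lemma measurable_rho (R : realType) (a b : R) (D : set R) :
  measurable_fun D (rho a b).
Proof.
apply: measurable_funTS; apply: measurable_funM; last exact: measurable_powR.
apply: (measurableT_comp (@measurable_powR R a)).
by apply: measurable_funB => //; exact: measurable_cst.
Qed.

Lemma rhoC (R : realType) (a b x : R) : rho a b (1 - x) = rho b a x.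
Proof. by rewrite /rho subKr mulrC. Qed.

Lemma rho_cvg0_right (R : realType) (a b : R) : 0 < b ->
  rho a b x @[x --> 0^'+] --> 0.
Proof.
move=> b0.
have c1 := @continuous_powRl R a 1 ltr01.
have c2 : (1 - x) `^ a @[x --> (0 : R)^'+] --> (1 : R) `^ a.
  apply: (@continuous_cvg _ _ _ _ _ (fun x : R => 1 - x) (fun y : R => y `^ a)) => //.
  apply: cvg_at_right_filter; rewrite -[X in _ --> X]subr0.
  by apply: cvgB; [exact: cvg_cst|exact: cvg_id].
rewrite -[X in _ --> X](mulr0 ((1 : R) `^ a)).
exact: (cvgM c2 (powR_cvg0 b0)).
Qed.

Lemma rho_cvg0_left (R : realType) (a b : R) : 0 < a ->
  rho a b x @[x --> 1^'-] --> 0.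
Proof.
move=> a0; apply/cvg_at_leftP => u [u1 ucvg].
have -> : (fun n => rho a b (u n)) = (fun n => rho b a (1 - u n)).
  by apply/funext => n; rewrite rhoC.
apply: (cvg_at_rightP _ _ _).1 (rho_cvg0_right b a0) _ _; split=> [n|].
  by rewrite subr_gt0.
by rewrite -(subrr (1 : R)); apply: cvgB => //; exact: cvg_cst.
Qed.

(** The antiderivative x^(p+1)/(p+1) has finite limits at both ends; the nonnegative fundamental
    theorem with g = 0 then shows that the integral is finite. *)
Lemma integrable_rho0l (R : realType) (p : R) : -1 < p ->
  (@lebesgue_measure R).-integrable `]0, 1[ (fun x => (rho 0 p x)%:E).
Proof.
move=> p1; have p0 : 0 < p + 1 by lra.
suff E : (\int[@lebesgue_measure R]_(x in `]0%R, 1%R[) (rho 0 p x)%:E + 0%:E =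
    \int[@lebesgue_measure R]_(x in `]0%R, 1%R[) (cst 0 x)%:E + ((p + 1)^-1)%:E)%E.
  apply/integrableP; split.
    by apply/measurable_EFinP; exact: measurable_rho.
  under eq_integral do rewrite gee0_abs ?lee_fin ?rho_ge0//.
  by move: E; rewrite adde0 => ->; rewrite integral0 add0e ltry.
apply: (@ge0_unit_FTC2 R _ _ ((fun x => x `^ (p + 1)) * cst (p + 1)^-1)).
- by move=> x; exact: continuous_rho.
- by move=> x _; exact: cst_continuous.
- by move=> x _; exact: rho_ge0.
- by [].
- move=> x /andP[x0 x1].
  have d2 : is_derive x 1 (fun x : R => x `^ (p + 1)) ((p + 1) * x `^ p).
    by have := @is_derive1_powR _ (p + 1) _ x0; rewrite addrK.
  have d3 := is_deriveM d2 (is_derive_cst ((p + 1)^-1) x 1).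
  apply: (is_derive_eq d3).
  rewrite /GRing.scale/= /rho powRr0; field.
  by rewrite gt_eqF.
- rewrite -[X in _ --> X](mul0r ((p + 1)^-1)).
  exact: (cvgM (powR_cvg0 p0) (cvg_cst _)).
- rewrite -[X in _ --> X]mul1r.
  apply: (@cvgM _ _ _ _ (fun x : R => x `^ (p + 1))); last exact: cvg_cst.
  rewrite -[X in _ --> X](_ : 1 `^ (p + 1) = 1); last by rewrite powR1.
  exact/cvg_at_left_filter/(@continuous_powRl R (p + 1) 1 ltr01).
Qed.

Lemma integrable_rho0r (R : realType) (p : R) : -1 < p ->
  (@lebesgue_measure R).-integrable `]0, 1[ (fun x => (rho p 0 x)%:E).
Proof.
move=> p1; have p0 : 0 < p + 1 by lra.
suff E : (\int[@lebesgue_measure R]_(x in `]0%R, 1%R[) (rho p 0 x)%:E + (- (p + 1)^-1)%:E =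
    \int[@lebesgue_measure R]_(x in `]0%R, 1%R[) (cst 0 x)%:E + 0%:E)%E.
  apply/integrableP; split.
    by apply/measurable_EFinP; exact: measurable_rho.
  under eq_integral do rewrite gee0_abs ?lee_fin ?rho_ge0//.
  move: E; rewrite integral0 adde0.
  by case: (\int[_]_(_ in _) _)%E => [r _| |]//; rewrite ltry.
apply: (@ge0_unit_FTC2 R _ _ (- (rho (p + 1) 0 * cst (p + 1)^-1))).
- by move=> x; exact: continuous_rho.
- by move=> x _; exact: cst_continuous.
- by move=> x _; exact: rho_ge0.
- by [].
- move=> x x01; have /andP[x0 x1] := x01.
  (* The second exponent -1 becomes 0 in the antiderivative, leaving a multiple of (1-x)^(p+1). *)
  have d2 := is_derive_rho p (- 1) x01; rewrite addNr in d2.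
  have d3 := is_deriveN (is_deriveM d2 (is_derive_cst ((p + 1)^-1) x 1)).
  apply: (is_derive_eq d3).
  rewrite /GRing.scale/= /rho powRr0 powR_inv1 ?ltW//; field.
  by rewrite !gt_eqF.
- have -> : rho (p + 1) 0 = (fun x : R => (1 - x) `^ (p + 1)).
    by apply/funext => x; rewrite /rho powRr0 mulr1.
  have cc : (1 - x) `^ (p + 1) @[x --> (0 : R)^'+] --> (1 : R) `^ (p + 1).
    apply: (@continuous_cvg _ _ _ _ _ (fun x : R => 1 - x)
      (fun y : R => y `^ (p + 1))).
      exact: (@continuous_powRl R (p + 1) 1 ltr01).
    apply: cvg_at_right_filter; rewrite -[X in _ --> X]subr0.
    by apply: cvgB; [exact: cvg_cst|exact: cvg_id].
  have := cvgN (cvgM cc (cvg_cst (p + 1)^-1)).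
  by rewrite powR1 mul1r; exact.
- have := cvgN (cvgM (rho_cvg0_left 0 p0) (cvg_cst (p + 1)^-1)).
  by rewrite mul0r oppr0; exact.
Qed.

(** On each half of the interval only one factor can be singular: the other is y^c with 1/2 <= y <=
    1 and c > -1, so y^c <= 1/y <= 2. *)
Lemma rho_le (R : realType) (a b x : R) : -1 < a -> -1 < b -> 0 < x < 1 ->
  rho a b x <= 2 * rho 0 b x + 2 * rho a 0 x.
Proof.
move=> a1 b1 /andP[x0 x1]; have y0 : 0 < 1 - x by rewrite subr_gt0.
have le2 (c y : R) : -1 < c -> 2^-1 <= y -> y <= 1 -> y `^ c <= 2.
  move=> c1 y2 y1; have y0' : 0 < y by apply: lt_le_trans y2; rewrite invr_gt0.
  apply: (@le_trans _ _ (y `^ (-1))); first by rewrite ger_powR ?y0'// ltW.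
  by rewrite powR_inv1 ?(ltW y0')// -[leRHS]invrK lef_pV2 ?posrE ?invr_gt0.
rewrite /rho !powRr0 mul1r mulr1.
have [x2|x2] := leP 2^-1 x.
  apply: (@le_trans _ _ (2 * (1 - x) `^ a)); last by rewrite lerDr mulr_ge0 ?powR_ge0.
  by rewrite mulrC ler_wpM2r ?powR_ge0// le2// ltW.
apply: (@le_trans _ _ (2 * x `^ b)); last by rewrite lerDl mulr_ge0 ?powR_ge0.
by rewrite ler_wpM2r ?powR_ge0// le2//; lra.
Qed.

Lemma integrable_rho (R : realType) (a b : R) : -1 < a -> -1 < b ->
  (@lebesgue_measure R).-integrable `]0, 1[ (fun x => (rho a b x)%:E).
Proof.
move=> a1 b1.
have i12 : (@lebesgue_measure R).-integrable `]0, 1[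
    (fun x => (2%:E * (rho 0 b x)%:E) + (2%:E * (rho a 0 x)%:E))%E.
  apply: integrableD => //; apply: integrableZl => //.
    exact: integrable_rho0l.
  exact: integrable_rho0r.
apply: le_integrable i12 => //.
  by apply/measurable_EFinP; exact: measurable_rho.
move=> x; rewrite /= in_itv/= => x01.
have r0 c d := rho_ge0 c d x.
rewrite lee_fin !ger0_norm ?addr_ge0 ?(mulr_ge0 _ (r0 _ _))//.
exact: rho_le.
Qed.

(** * Orthogonality *)

Lemma horner_unit_bounded (R : realType) (p : {poly R}) :
  exists M, forall x, 0 < x < 1 -> `|p.[x]| <= M.
Proof.
elim/poly_ind: p => [|p c [M pM]]; first by exists 0 => x _; rewrite horner0 normr0.
exists (M + `|c|) => x x01; rewrite !hornerE.
apply: (le_trans (ler_normD _ _)); rewrite lerD2r normrM.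
have /andP[x0 x1] := x01; rewrite -[leRHS]mulr1 ler_pM ?pM//.
by rewrite gtr0_norm// ltW.
Qed.

Lemma integrable_rho_horner (R : realType) (a b : R) (p : {poly R}) :
  -1 < a -> -1 < b ->
  (@lebesgue_measure R).-integrable `]0, 1[ (fun x => (rho a b x * p.[x])%:E).
Proof.
move=> a1 b1; have [M pM] := horner_unit_bounded p.
rewrite (_ : (fun x => _) = ((EFin \o horner p) \* (fun x => (rho a b x)%:E))%E);
  last by apply/funext => x /=; rewrite mulrC EFinM.
apply: integrableMr => //.
- by apply: measurable_funTS; apply: continuous_measurable_fun; exact: continuous_horner.
- exists M; split; first exact: num_real.
  move=> y My x /=; rewrite in_itv/= => x01.
  exact: le_trans (pM _ x01) (ltW My).
- exact: integrable_rho.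
Qed.

(** Integration against the weight as a functional on formal polynomials, which turns the
    orthogonality arguments into algebra. *)
Definition rho_int (R : realType) (a b : R) (p : {poly R}) : R :=
  \int[@lebesgue_measure R]_(x in `]0, 1[) (rho a b x * p.[x]).

Section rho_int.
Context (R : realType).
Implicit Types (a b : R) (p q : {poly R}).

Lemma rho_intD a b p q : -1 < a -> -1 < b ->
  rho_int a b (p + q) = rho_int a b p + rho_int a b q.
Proof.
move=> a1 b1; rewrite /rho_int -RintegralD//; try exact: integrable_rho_horner.
by apply: eq_Rintegral => x _; rewrite hornerD mulrDr.
Qed.

Lemma rho_intZ a b c p : -1 < a -> -1 < b ->
  rho_int a b (c *: p) = c * rho_int a b p.
Proof.
move=> a1 b1; rewrite /rho_int -RintegralZl//; try exact: integrable_rho_horner.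
by apply: eq_Rintegral => x _; rewrite hornerZ mulrCA.
Qed.

Lemma rho_int0 a b : rho_int a b 0 = 0.
Proof.
rewrite /rho_int; under eq_Rintegral do rewrite horner0 mulr0.
by rewrite Rintegral_cst// mul0r.
Qed.

(** The integrand is the derivative of rho^(a+1,b+1) q, which vanishes at both ends because a+1 and
    b+1 are positive. *)
Lemma rho_int_deriv a b q : -1 < a -> -1 < b ->
  rho_int a b ('X * (1 - 'X) * q^`() +
    ((b + 1) *: (1 - 'X) - (a + 1) *: 'X) * q) = 0.
Proof.
move=> a1 b1; set r := (X in rho_int a b X).
pose h x := rho a b x * r.[x].
have ch (x : R) : 0 < x < 1 -> {for x, continuous h}.
  move=> x01; apply: continuousM; first exact: continuous_rho.
  exact: continuous_horner.
have ih : (@lebesgue_measure R).-integrable `]0, 1[ (EFin \o h).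
  exact: integrable_rho_horner.
have inh : (@lebesgue_measure R).-integrable `]0, 1[ (EFin \o (fun x => `|h x|)).
  exact: (integrable_norm ih).
have nch (x : R) : 0 < x < 1 -> {for x, continuous (fun x => `|h x|)}.
  by move=> /ch hx; apply: (continuous_comp hx); exact: norm_continuous.
(* The integrand [h] has no fixed sign, so it is written as the difference of the nonnegative h +
   |h| and |h|. *)
have dr (x : R) : 0 < x < 1 ->
    is_derive x 1 (rho (a + 1) (b + 1) * horner q) (h x + `|h x| - `|h x|).
  move=> x01; rewrite addrK.
  have d := is_deriveM (is_derive_rho a b x01) (is_derive_poly q x).
  apply: (is_derive_eq d); have /andP[x0 x1] := x01.
  rewrite /GRing.scale/= /h /r !(hornerD, hornerN, hornerM, hornerZ, hornerX).
  rewrite (_ : 1.[x] = 1); last exact: hornerC.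
  rewrite /rho.
  rewrite (powRD (r := a)) ?(gt_eqF (_ : 0 < 1 - x)) ?subr_gt0 ?implybT//.
  rewrite (powRD (r := b)) ?(gt_eqF x0) ?implybT//.
  by rewrite !powRr1 ?ltW ?subr_gt0//; ring.
have := @ge0_unit_FTC2 R (fun x => h x + `|h x|) (fun x => `|h x|)
  (rho (a + 1) (b + 1) * horner q) 0 0.
move=> E; have {}E : (\int[@lebesgue_measure R]_(x in `]0%R, 1%R[) (h x + `|h x|)%:E
   + 0%:E = \int[@lebesgue_measure R]_(x in `]0%R, 1%R[) (`|h x|)%:E + 0%:E)%E.
  apply: E => //.
  - by move=> x x01; apply: continuousD; [exact: ch|exact: nch].
  - by move=> x _; have := ler_norm (- h x); rewrite normrN; lra.
  - have qc : q.[x] @[x --> (0 : R)^'+] --> q.[0].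
      by apply: cvg_at_right_filter; exact: continuous_horner.
    have b0 : 0 < b + 1 by lra.
    by have := cvgM (rho_cvg0_right (a + 1) b0) qc; rewrite mul0r; exact.
  - have qc : q.[x] @[x --> (1 : R)^'-] --> q.[1].
      by apply: cvg_at_left_filter; exact: continuous_horner.
    have a0 : 0 < a + 1 by lra.
    by have := cvgM (rho_cvg0_left (b + 1) a0) qc; rewrite mul0r; exact.
have {}E : \int[@lebesgue_measure R]_(x in `]0, 1[) (h x + `|h x|) =
    \int[@lebesgue_measure R]_(x in `]0, 1[) `|h x|.
  by move: E; rewrite !adde0 /Rintegral => ->.
by move: E; rewrite RintegralD//; rewrite -/(rho_int a b r); lra.
Qed.

Lemma rho_int_shift a b p :
  rho_int a b ('X * (1 - 'X) * p) = rho_int (a + 1) (b + 1) p.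
Proof.
apply: eq_Rintegral => x; rewrite inE/= in_itv/= => /andP[x0 x1].
rewrite !(hornerD, hornerN, hornerM, hornerX).
rewrite (_ : 1.[x] = 1); last exact: hornerC.
rewrite /rho.
rewrite (powRD (r := a)) ?(gt_eqF (_ : 0 < 1 - x)) ?subr_gt0 ?implybT//.
rewrite (powRD (r := b)) ?(gt_eqF x0) ?implybT//.
by rewrite !powRr1 ?ltW ?subr_gt0//; ring.
Qed.

(** Integration by parts: [rho_int_deriv] is applied to the product [q * p], and the Rodrigues
    identity collects the terms in which [p] is not differentiated. *)
Lemma rho_int_jacobi_by_parts a b n p : -1 < a -> -1 < b ->
  n.+1%:R * rho_int a b (jacobi_poly a b n.+1 * p) =
  rho_int (a + 1) (b + 1) (jacobi_poly (a + 1) (b + 1) n * p^`()).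
Proof.
move=> a1 b1; set q := jacobi_poly (a + 1) (b + 1) n.
have := @rho_int_deriv a b (q * p) a1 b1.
have -> : 'X * (1 - 'X) * (q * p)^`() +
    ((b + 1) *: (1 - 'X) - (a + 1) *: 'X) * (q * p) =
    'X * (1 - 'X) * (q * p^`()) +
    ('X * (1 - 'X) * q^`() + ((b + 1) *: (1 - 'X) - (a + 1) *: 'X) * q) * p.
  by rewrite derivM; ring.
rewrite jacobi_poly_rodrigues rho_intD// rho_int_shift -scalerAl rho_intZ//.
lra.
Qed.

(** Integration by parts lowers both degrees and raises both exponents by one, so the induction
    generalises over [a] and [b]. It ends when one factor is constant and its derivative is 0. *)
Lemma rho_int_jacobi_orth a b n m : -1 < a -> -1 < b -> (n != m)%N ->
  rho_int a b (jacobi_poly a b n * jacobi_poly a b m) = 0.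
Proof.
elim: n m a b => [|n IH] [|m] a b a1 b1 nm //.
- have := @rho_int_jacobi_by_parts a b m 1 a1 b1.
  rewrite (_ : 1^`() = 0 :> {poly R}); last exact: derivC.
  rewrite mulr0 rho_int0 => /eqP; rewrite mulf_eq0 pnatr_eq0/= => /eqP.
  by rewrite jacobi_poly0 mulrC.
- have := @rho_int_jacobi_by_parts a b n 1 a1 b1.
  rewrite (_ : 1^`() = 0 :> {poly R}); last exact: derivC.
  rewrite mulr0 rho_int0 => /eqP; rewrite mulf_eq0 pnatr_eq0/= => /eqP.
  by rewrite jacobi_poly0.
- have := @rho_int_jacobi_by_parts a b n (jacobi_poly a b m.+1) a1 b1.
  rewrite deriv_jacobi_poly -scalerAr rho_intZ; [|lra..].
  rewrite IH//; [|lra..].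
  by rewrite mulr0 => /eqP; rewrite mulf_eq0 pnatr_eq0/= => /eqP.
Qed.

Lemma rho_int_jacobi_sqrS a b n : -1 < a -> -1 < b ->
  n.+1%:R * rho_int a b (jacobi_poly a b n.+1 ^+ 2) =
  (n%:R + a + b + 2) *
    rho_int (a + 1) (b + 1) (jacobi_poly (a + 1) (b + 1) n ^+ 2).
Proof.
move=> a1 b1.
rewrite expr2 rho_int_jacobi_by_parts// deriv_jacobi_poly -scalerAr -expr2.
by rewrite rho_intZ//; lra.
Qed.

(** Reflection exchanges y-1 and y+1 up to sign; reversing the summation index exchanges the
    binomials accordingly. *)
Lemma jacobiG_onem a b n x : jacobiG a b n (1 - x) = (-1) ^+ n * jacobiG b a n x.
Proof.
rewrite /jacobiG /jacobiP mulrCA; congr (_ * _).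
rewrite mulr_sumr (reindex_inj rev_ord_inj)/=; apply: eq_bigr => -[m]/=.
rewrite ltnS subSS => mn _; rewrite subKn//.
have -> : 2 * (1 - x) - 1 - 1 = - (2 * x - 1 + 1) by ring.
have -> : 2 * (1 - x) - 1 + 1 = - (2 * x - 1 - 1) by ring.
have -> : (-1) ^+ n = (-1) ^+ m * (-1) ^+ (n - m) :> R by rewrite -exprD subnKC.
rewrite (exprNn (2 * x - 1 + 1)) (exprNn (2 * x - 1 - 1)); ring.
Qed.

(** Substitution of 1-x for x. For positive exponents the integrand is continuous on the closed
    segment, as the change of variables requires. *)
Lemma rho_int_jacobi_sqrC a b n : 0 < a -> 0 < b ->
  rho_int a b (jacobi_poly a b n ^+ 2) = rho_int b a (jacobi_poly b a n ^+ 2).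
Proof.
move=> a0 b0; rewrite /rho_int.
have cw : {within `[0, 1], continuous (fun x => rho a b x * (jacobi_poly a b n ^+ 2).[x])}.
  apply/continuous_within_itvP => //; split.
  - move=> x; rewrite in_itv/= => x01; apply: continuousM; first exact: continuous_rho.
    exact: continuous_horner.
  - apply: cvgM.
      rewrite [X in _ --> X](_ : _ = 0); first exact: rho_cvg0_right.
      by rewrite /rho powR0 ?mulr0// gt_eqF.
    by apply: cvg_at_right_filter; exact: continuous_horner.
  - apply: cvgM.
      rewrite [X in _ --> X](_ : _ = 0); first exact: rho_cvg0_left.
      by rewrite /rho subrr powR0 ?mul0r// gt_eqF.
    by apply: cvg_at_left_filter; exact: continuous_horner.
have oo (h : R -> R) : measurable_fun (`]0, 1[%classic : set (measurableTypeR R)) (EFin \o h) ->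
    \int[@lebesgue_measure R]_(x in `[0, 1]) h x = \int[@lebesgue_measure R]_(x in `]0, 1[) h x.
  by move=> mh; rewrite /Rintegral integral_itv_bndoo.
have mh c d : measurable_fun (`]0, 1[%classic : set (measurableTypeR R))
    (EFin \o (fun x => rho c d x * (jacobi_poly c d n ^+ 2).[x])).
  apply/measurable_EFinP; apply: measurable_funM; first exact: measurable_rho.
  by apply: measurable_funTS; apply: continuous_measurable_fun; exact: continuous_horner.
have := @Rintegration_by_substitution_onem R (fun x => rho a b x * (jacobi_poly a b n ^+ 2).[x]) 1.
rewrite ler01 lexx => /(_ isT cw).
rewrite {1}/unstable.onem subrr.
have -> : (fun x => rho a b (unstable.onem x) * (jacobi_poly a b n ^+ 2).[unstable.onem x]) =
    (fun x => rho b a x * (jacobi_poly b a n ^+ 2).[x]).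
  apply/funext => x; rewrite /unstable.onem rhoC !horner_exp -!jacobiGE jacobiG_onem.
  by rewrite exprMn sqrr_sign mul1r.
by rewrite !oo.
Qed.

End rho_int.

(** * The Gamma function and the constants lambda *)

(** For an integer k >= s and t >= 1, t^s <= t^k and exp t >= t^(k+1)/(k+1)!, so the product is at
    most (k+1)!/t. *)
Lemma powR_expRN_cvg0 (R : realType) (s : R) : 0 < s ->
  n.+2%:R `^ s * expR (- n.+2%:R) @[n --> \oo] --> (0 : R).
Proof.
move=> s0; pose k := Num.bound s.
have sk : s <= k%:R by rewrite ltW// archi_boundP// ltW.
apply: (@squeeze_cvgr _ _ _ _ (cst 0) (fun n => k.+1`!%:R * n.+1%:R^-1)).
- apply: nearW => n; rewrite mulr_ge0 ?powR_ge0 ?expR_ge0//=.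
  have t0 : 0 < n.+2%:R :> R by [].
  have fk : 0 < k.+1`!%:R :> R by rewrite ltr0n fact_gt0.
  have ek : n.+2%:R ^+ k.+1 / k.+1`!%:R <= expR n.+2%:R :> R.
    by apply: le_trans (expR_ge1Dxn k (ltW t0)); rewrite lerDr.
  have sk' : n.+2%:R `^ s <= n.+2%:R ^+ k :> R.
    by rewrite -powR_mulrn ?ler_powR// ler1n.
  rewrite expRN ler_pdivrMr ?expR_gt0// (le_trans sk')//.
  apply: (@le_trans _ _ (k.+1`!%:R / n.+2%:R * expR n.+2%:R)).
    apply: le_trans (ler_wpM2l _ ek); last by rewrite divr_ge0// ltW.
    rewrite le_eqVlt; apply/orP; left; apply/eqP; rewrite exprS; field.
    by rewrite !gt_eqF.
  apply: ler_wpM2r; first exact: expR_ge0.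
  apply: ler_wpM2l; first exact: ltW.
  by rewrite lef_pV2 ?posrE// ler_nat.
- exact: cvg_cst.
- rewrite -[X in _ --> X](mulr0 (k.+1`!%:R)).
  by apply: cvgM; [exact: cvg_cst|exact: cvg_harmonic].
Qed.

(* Both sides are 0 should the integrals diverge, hence no integrability. *)
Lemma GammaS (R : realType) (s : R) : 0 < s -> Gamma (s + 1) = s * Gamma s.
Proof.
move=> s0.
have in0y x : (`]0, +oo[%classic : set R) x -> 0 < x.
  by rewrite /= in_itv/= andbT.
pose g (t : R) := t `^ s * expR (- t).
pose f (t : R) := t `^ (s - 1) * expR (- t).
have dE (x : R) : is_derive x 1 (fun t : R => expR (- t)) (- expR (- x)).
  have := @is_derive1_comp R expR -%R x _ _ _ _.
  by move=> /(_ _ _ (is_derive_expR _) (is_deriveN (is_derive_id x 1))); rewrite mulrN1.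
have dP (p x : R) : 0 < x -> is_derive x 1 (fun t : R => t `^ p * expR (- t))
    (p * (x `^ (p - 1) * expR (- x)) - x `^ p * expR (- x)).
  move=> x0; have d := is_deriveM (is_derive1_powR p x0) (dE x).
  by apply: (is_derive_eq d); rewrite /GRing.scale/=; ring.
have cP (p x : R) : 0 < x -> {for x, continuous (fun t : R => t `^ p * expR (- t))}.
  by move=> /(dP p)[+ _] => /derivable1_diffP /differentiable_continuous.
(* Here [g] plays two parts: it is the antiderivative of s f - g, vanishing at both ends, and it is
   the integrand of Gamma(s+1). *)
have E : (\int[@lebesgue_measure R]_(x in `]0%R, +oo[) (s * f x)%:E + 0%:E =
   \int[@lebesgue_measure R]_(x in `]0%R, +oo[) (g x)%:E + 0%:E)%E.
  apply: (@ge0_exhaustion_FTC2 R _ (fun n => n.+2%:R^-1) (fun n => n.+2%:R) _ _ g).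
  - move=> n; rewrite (@le_lt_trans _ _ 1)// ?ltr1n//.
    by rewrite invf_le1 ?ler1n.
  - apply/nondecreasing_seqP => n; rewrite subsetEset; apply: subset_itv.
      by rewrite bnd_simp lef_pV2 ?posrE// ler_nat.
    by rewrite bnd_simp ler_nat.
  - apply/seteqP; split=> [x /in0y x0|x [n _]]; last first.
      rewrite /= !in_itv/= andbT => /andP[+ _]; apply: lt_le_trans.
      by rewrite invr_gt0.
    pose n := maxn (Num.bound x) (Num.bound x^-1).
    have nx : x <= n.+2%:R.
      apply: le_trans (ltW (archi_boundP (ltW x0))) _.
      by rewrite ler_nat !leqW// leq_maxl.
    have nx' : x^-1 <= n.+2%:R.
      apply: le_trans (ltW (archi_boundP _)) _; first by rewrite invr_ge0 ltW.
      by rewrite ler_nat !leqW// leq_maxr.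
    exists n => //=; rewrite in_itv/= nx andbT.
    by rewrite -[leRHS]invrK lef_pV2 ?posrE ?invr_gt0.
  - move=> x /in0y x0; apply: continuousM; first exact: cst_continuous.
    exact: cP.
  - by move=> x /in0y x0; exact: cP.
  - by move=> x _; rewrite mulr_ge0 ?(ltW s0)// mulr_ge0 ?powR_ge0 ?expR_ge0.
  - by move=> x _; rewrite mulr_ge0 ?powR_ge0 ?expR_ge0.
  - by move=> x /in0y x0; exact: dP.
  - have c0 : g t @[t --> (0 : R)^'+] --> (0 : R).
      have ce : {for (0 : R), continuous (fun t : R => expR (- t))}.
        by have [+ _] := dE 0; move=> /derivable1_diffP /differentiable_continuous.
      have := cvgM (powR_cvg0 s0) (cvg_at_right_filter ce).
      by rewrite mul0r; exact.
    apply: (cvg_at_rightP _ _ _).1 c0 _ _; split=> [n|].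
      by rewrite invr_gt0.
    by have := @cvg_harmonic R; rewrite -(cvg_shiftn 1)/=; under eq_fun do rewrite addn1.
  - exact: powR_expRN_cvg0.
move: E; rewrite !adde0 /Gamma /Rintegral addrK => <-.
under [in LHS]eq_integral do rewrite EFinM.
rewrite ge0_integralZl_EFin ?(ltW s0)//.
- pose I := (\int[@lebesgue_measure R]_(x in `]0%R, +oo[) (f x)%:E)%E.
  rewrite -[LHS]/(fine (s%:E * I)) -[RHS]/(s * fine I).
  have : (0 <= I)%E.
    by apply: integral_ge0 => x _; rewrite lee_fin mulr_ge0 ?powR_ge0 ?expR_ge0.
  case: I => [r _|_|]//=.
  by rewrite gt0_muley ?lte_fin//= mulr0.
- by move=> x _; rewrite lee_fin mulr_ge0 ?powR_ge0 ?expR_ge0.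
- apply/measurable_EFinP; apply: measurable_funTS; apply: measurable_funM.
    exact: measurable_powR.
  by apply: measurableT_comp; [exact: measurable_expR|exact: oppr_measurable].
Qed.

Lemma lambdaS (R : realType) (alpha beta : R) n : 0 < alpha ->
  lambda alpha beta n.+1 =
  lambda alpha beta n * ((n%:R + alpha) / n.+1%:R).
Proof.
move=> a0; rewrite /lambda -natr1 addrAC GammaS; last by rewrite ltr_wpDl.
rewrite factS natrM natr1 -!mulrA; congr (_ * _).
by rewrite invfM; ring.
Qed.

(** Consecutive values have ratio (n+alpha)/(n+1) >= 1. The recurrence inverts factor by factor,
    also under the convention 0^-1 = 0. *)
Lemma lambdaV_le (R : realType) (alpha beta : R) n m : 1 <= alpha ->
  (n <= m)%N ->
  `|lambda alpha beta m|^-1 <= `|lambda alpha beta n|^-1.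
Proof.
move=> a1; elim: m => [|m IH]; first by rewrite leqn0 => /eqP ->.
rewrite leq_eqVlt ltnS => /predU1P[->//|/IH]; apply: le_trans.
rewrite lambdaS ?(lt_le_trans ltr01)// normrM invfM ler_piMr ?invr_ge0//.
have p0 : 0 < m%:R + alpha by rewrite ltr_wpDl// (lt_le_trans ltr01).
rewrite gtr0_norm ?divr_gt0// invf_div ler_pdivrMr// mul1r -natr1.
by rewrite lerD2l.
Qed.

(** Young's inequality for the factors (1+x)^p and 1, with exponents 1/p and 1/(1-p), gives p (1+x)
    + (1-p). *)
Lemma powR_bernoulli (R : realType) (p x : R) : 0 < p -> p < 1 -> 0 <= x ->
  (1 + x) `^ p <= 1 + p * x.
Proof.
move=> p0 p1 x0.
have q0 : 0 < 1 - p by rewrite subr_gt0.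
have := @conjugate_powR R ((1 + x) `^ p) 1 p^-1 (1 - p)^-1 (powR_ge0 _ _) ler01.
rewrite !invrK !invr_gt0 => /(_ p0 q0); rewrite subrKC => /(_ erefl).
rewrite mulr1 -powRrM mulfV ?gt_eqF// powRr1 ?addr_ge0// powR1.
lra.
Qed.

(** The induction step is Bernoulli's inequality with exponent alpha-1 at x = 1/(n+1), whose right
    side is the ratio (n+alpha)/(n+1). *)
Lemma lambdaV_bound (R : realType) (alpha beta : R) n : 1 < alpha -> alpha < 2 ->
  `|lambda alpha beta n|^-1 <=
  `|lambda alpha beta 0|^-1 * n.+1%:R `^ (- alpha + 1).
Proof.
move=> a1 a2; elim: n => [|n IH]; first by rewrite powR1 mulr1.
have p0 : 0 < n%:R + alpha by rewrite ltr_wpDl// (lt_trans ltr01).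
rewrite lambdaS ?(lt_trans ltr01)// normrM invfM.
rewrite (@gtr0_norm _ ((n%:R + alpha) / _)) ?divr_gt0// invf_div.
have n0 : 0 < n.+1%:R / (n%:R + alpha) by rewrite divr_gt0.
apply: le_trans (ler_wpM2r (ltW n0) IH) _.
rewrite -mulrA ler_wpM2l ?invr_ge0//.
have := @powR_bernoulli R (alpha - 1) (n.+1%:R^-1) _ _ _.
rewrite subr_gt0 invr_ge0 ler0n => /(_ a1) H.
have {}H := H ltac:(lra) isT.
have -> : - alpha + 1 = - (alpha - 1) by ring.
have E : n.+2%:R = n.+1%:R * (1 + n.+1%:R^-1) :> R.
  by rewrite mulrDr mulr1 divff ?natr1// pnatr_eq0.
rewrite !powRN -[leRHS]mul1r ler_pdivlMr ?powR_gt0// E.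
rewrite powRM ?addr_ge0 ?invr_ge0//.
have u0 : 0 < n.+1%:R `^ (alpha - 1) :> R by rewrite powR_gt0.
move: H; set W := _ `^ _ => H.
rewrite mulrACA mulVf ?mul1r ?gt_eqF//.
apply: le_trans (ler_wpM2l (ltW n0) H) _.
rewrite le_eqVlt; apply/orP; left; apply/eqP; rewrite -natr1; field.
have nn : 0 <= n%:R :> R by [].
by apply/andP; split; apply/negP => /eqP; lra.
Qed.

(** * Bessel's inequality *)

Section wnorm.
Context (R : realType).
Implicit Types (w f g : R -> R).

Let mu := @lebesgue_measure R.

Lemma wnorm_ge0 w f : (0 <= wnorm w f)%E.
Proof. exact: poweR_ge0. Qed.

Lemma wnorm_sqr w f : (forall x, 0 <= w x) ->
  (wnorm w f `^ 2 = \int[mu]_(x in `]0%R, 1%R[) (w x * f x ^+ 2)%:E)%E.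
Proof.
move=> w0; rewrite /wnorm -poweRrM mulVf// poweRe1//.
by apply: integral_ge0 => x _; rewrite lee_fin mulr_ge0 ?sqr_ge0.
Qed.

Lemma wnorm_le w v f g (c : R) : (forall x, 0 <= w x) -> (forall x, 0 <= v x) ->
  0 <= c ->
  (\int[mu]_(x in `]0%R, 1%R[) (w x * f x ^+ 2)%:E <=
   (c ^+ 2)%:E * \int[mu]_(x in `]0%R, 1%R[) (v x * g x ^+ 2)%:E)%E ->
  (wnorm w f <= c%:E * wnorm v g)%E.
Proof.
move=> w0 v0 c0 fg.
have -> : (c%:E * wnorm v g = ((c ^+ 2)%:E *
    \int[mu]_(x in `]0%R, 1%R[) (v x * g x ^+ 2)%:E) `^ 2^-1)%E.
  rewrite poweRM ?lee_fin ?sqr_ge0//; last first.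
    by apply: integral_ge0 => x _; rewrite lee_fin mulr_ge0 ?sqr_ge0.
  by rewrite poweR_EFin powR12_sqrt ?sqr_ge0// sqrtr_sqr ger0_norm.
have i0 : (0 <= \int[mu]_(x in `]0%R, 1%R[) (w x * f x ^+ 2)%:E)%E.
  by apply: integral_ge0 => x _; rewrite lee_fin mulr_ge0 ?sqr_ge0.
apply: gt0_ler_poweR => //.
  by rewrite in_itv/= i0 leey.
by rewrite in_itv/= (le_trans i0 fg) leey.
Qed.

Lemma L2wP w f : (forall x, 0 <= w x) -> measurable_fun (`]0, 1[ : set R) w ->
  L2w w f <-> measurable_fun (`]0, 1[ : set R) f /\
    mu.-integrable `]0, 1[ (fun x => (w x * f x ^+ 2)%:E).
Proof.
move=> w0 mw; split=> -[mf fi]; split=> //.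
  apply/integrableP; split.
    by apply/measurable_EFinP; apply: measurable_funM => //; exact: measurable_funX.
  under eq_integral do rewrite gee0_abs ?lee_fin ?(mulr_ge0 (w0 _))?sqr_ge0//.
  by move: fi => /lty_poweRy; apply; rewrite invr_eq0 pnatr_eq0.
rewrite /wnorm; apply: poweR_lty; move/integrableP : fi => [_].
by under eq_integral do rewrite gee0_abs ?lee_fin ?(mulr_ge0 (w0 _))?sqr_ge0//.
Qed.

End wnorm.

Section bessel.
Context (R : realType) (a b : R) (f : R -> R).
Hypotheses (a1 : -1 < a) (b1 : -1 < b) (f2 : L2w (rho a b) f).

Let mu := @lebesgue_measure R.
Let P := jacobi_poly a b.

Let mf : measurable_fun (`]0, 1[ : set R) f. Proof. by case: f2. Qed.

Let if2 : mu.-integrable `]0, 1[ (fun x => (rho a b x * f x ^+ 2)%:E).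
Proof.
have [+ _] := @L2wP R (rho a b) f (fun x => rho_ge0 a b x)
  (@measurable_rho R a b _).
by move=> /(_ f2)[].
Qed.

(** Pointwise |f p| <= f^2 + p^2, and both squares are integrable against the weight. *)
Lemma integrable_rho_mul_horner (p : {poly R}) :
  mu.-integrable `]0, 1[ (fun x => (rho a b x * f x * p.[x])%:E).
Proof.
have i2 : mu.-integrable `]0, 1[
    (fun x => (rho a b x * f x ^+ 2)%:E + (rho a b x * (p ^+ 2).[x])%:E)%E.
  by apply: integrableD => //; exact: integrable_rho_horner.
apply: le_integrable i2 => //.
  apply/measurable_EFinP; apply: measurable_funM.
    by apply: measurable_funM => //; exact: measurable_rho.
  by apply: measurable_funTS; apply: continuous_measurable_fun; exact: continuous_horner.
move=> x _; rewrite horner_exp -EFinD lee_fin -mulrA -mulrDr.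
rewrite [leLHS]normrM [leRHS]normrM ler_wpM2l//.
rewrite [leRHS]ger0_norm ?addr_ge0 ?sqr_ge0//.
have := sqr_ge0 (f x - p.[x]); have := sqr_ge0 (f x + p.[x]).
by rewrite ler_norml => ? ?; apply/andP; split; nra.
Qed.

Let L (p : {poly R}) : R :=
  \int[mu]_(x in `]0, 1[) (rho a b x * f x * p.[x]).

Let LD p q : L (p + q) = L p + L q.
Proof.
rewrite /L -RintegralD//; try exact: integrable_rho_mul_horner.
by apply: eq_Rintegral => x _; rewrite hornerD mulrDr.
Qed.

Let LZ c p : L (c *: p) = c * L p.
Proof.
rewrite /L -RintegralZl//; last exact: integrable_rho_mul_horner.
by apply: eq_Rintegral => x _; rewrite hornerZ mulrCA.
Qed.

(** Pythagoras for a block of indices; it serves both the projection in Bessel's inequality and the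
    tails of the series. *)
Lemma rho_int_sum_sqr (c : nat -> R) n m :
  rho_int a b ((\sum_(n <= i < m) c i *: P i) ^+ 2) =
  \sum_(n <= i < m) c i ^+ 2 * rho_int a b (P i ^+ 2).
Proof.
have orth k j : (forall i, (n <= i < k)%N -> i != j) ->
    rho_int a b ((\sum_(n <= i < k) c i *: P i) * P j) = 0.
  elim: k => [|k IH] kj; first by rewrite big_geq// mul0r rho_int0.
  have [nk|nk] := leqP n k; last by rewrite big_geq// mul0r rho_int0.
  rewrite big_nat_recr//= mulrDl rho_intD// IH; last first.
    by move=> i /andP[ni ik]; apply: kj; rewrite ni ltnW.
  rewrite -scalerAl rho_intZ// rho_int_jacobi_orth ?mulr0 ?addr0//.
  by apply: kj; rewrite nk leqnn.
elim: m => [|m IH]; first by rewrite !big_geq// expr0n rho_int0.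
have [nm|nm] := leqP n m; last by rewrite !big_geq// expr0n rho_int0.
have E : rho_int a b ((\sum_(n <= i < m) c i *: P i) * (c m *: P m)) = 0.
  rewrite -scalerAr rho_intZ// orth ?mulr0// => i /andP[_ im].
  by rewrite ltn_eqF.
by rewrite !big_nat_recr//= sqrrD mulr2n !rho_intD// E !addr0 IH exprZn rho_intZ.
Qed.

(* A vanishing norm would contribute 0, as x / 0 = 0; positivity of the norms is
   thus not needed. *)
Lemma jacobi_bessel n :
  \sum_(0 <= i < n) L (P i) ^+ 2 / rho_int a b (P i ^+ 2) <=
  \int[mu]_(x in `]0, 1[) (rho a b x * f x ^+ 2).
Proof.
(* These are the Fourier coefficients of [f], so [p] is its projection. As the squared norm of [p]
   equals [L p], that of f - p is the squared norm of [f] minus [L p]. *)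
pose c i := L (P i) / rho_int a b (P i ^+ 2).
pose p := \sum_(0 <= i < n) c i *: P i.
have Lp : L p = \sum_(0 <= i < n) L (P i) ^+ 2 / rho_int a b (P i ^+ 2).
  rewrite /p; elim: n {p} => [|n IH].
    by rewrite !big_geq// -(scale0r 0) LZ mul0r.
  rewrite !big_nat_recr//= LD IH LZ; congr (_ + _).
  by rewrite /c expr2 mulrAC.
have pp : rho_int a b (p ^+ 2) = L p.
  rewrite rho_int_sum_sqr Lp; apply: eq_bigr => i _; rewrite /c.
  have [->|n0] := eqVneq (rho_int a b (P i ^+ 2)) 0; first by rewrite mulr0 invr0 mulr0.
  by field.
have : 0 <= \int[mu]_(x in `]0, 1[) (rho a b x * (f x - p.[x]) ^+ 2).
  by apply: Rintegral_ge0 => x _; rewrite mulr_ge0 ?rho_ge0 ?sqr_ge0.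
have -> : \int[mu]_(x in `]0, 1[) (rho a b x * (f x - p.[x]) ^+ 2) =
   \int[mu]_(x in `]0, 1[) (rho a b x * f x ^+ 2) - 2 * L p + rho_int a b (p ^+ 2).
  rewrite /L /rho_int -RintegralZl//; last exact: integrable_rho_mul_horner.
  have iZ : mu.-integrable `]0, 1[ (EFin \o (fun x => 2 * (rho a b x * f x * p.[x]))).
    rewrite (_ : _ \o _ = fun x => 2%:E * (rho a b x * f x * p.[x])%:E)%E//.
    by apply: integrableZl => //; exact: integrable_rho_mul_horner.
  have iB : mu.-integrable `]0, 1[ (EFin \o (fun x =>
      rho a b x * f x ^+ 2 - 2 * (rho a b x * f x * p.[x]))).
    rewrite (_ : _ \o _ = fun x => (rho a b x * f x ^+ 2)%:E -
      (2 * (rho a b x * f x * p.[x]))%:E)%E//.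
    exact: integrableB.
  rewrite -RintegralB// -RintegralD//; last exact: integrable_rho_horner.
  by apply: eq_Rintegral => x _; rewrite horner_exp; ring.
by rewrite pp Lp; lra.
Qed.

End bessel.

(** * The series *)

Lemma jacobiG_norm_sqr (R : realType) (a b : R) n :
  jacobiG_norm a b n ^+ 2 = rho_int a b (jacobi_poly a b n ^+ 2).
Proof.
rewrite /jacobiG_norm sqr_sqrtr; last first.
  by apply: Rintegral_ge0 => x _; rewrite mulr_ge0 ?rho_ge0 ?sqr_ge0.
by apply: eq_Rintegral => x _; rewrite jacobiGE horner_exp.
Qed.

Lemma rho_int_sqr_ge0 (R : realType) (a b : R) (p : {poly R}) :
  0 <= rho_int a b (p ^+ 2).
Proof.
by apply: Rintegral_ge0 => x _; rewrite horner_exp mulr_ge0 ?rho_ge0 ?sqr_ge0.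
Qed.

(** The ratio of the left side to the right side is (n+1)/(n+a+b), obtained from
    [rho_int_jacobi_sqrS] at the exponents b-1, a-1 and then the reflection. *)
Lemma rho_int_jacobi_sqr_le (R : realType) (a b : R) n :
  0 < a -> 0 < b -> 1 <= a + b ->
  rho_int a b (jacobi_poly a b n ^+ 2) <=
  rho_int (b - 1) (a - 1) (jacobi_poly (b - 1) (a - 1) n.+1 ^+ 2).
Proof.
move=> a0 b0 ab.
have := @rho_int_jacobi_sqrS R (b - 1) (a - 1) n ltac:(lra) ltac:(lra).
rewrite !subrK (@rho_int_jacobi_sqrC _ b a)//.
have := rho_int_sqr_ge0 a b (jacobi_poly a b n).
set u := rho_int a b _; set v := rho_int (b - 1) _ _ => u0 E.
rewrite -(ler_pM2l (_ : 0 < n.+1%:R))// E ler_wpM2r// -natr1.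
lra.
Qed.

Section series.
Context (R : realType) (alpha beta : R).
Hypotheses (alpha1 : 1 < alpha) (alpha2 : alpha < 2).
Hypotheses (beta_ge : alpha - 1 <= beta) (beta1 : beta < 1).
Context (f : R -> R).
Hypothesis f2 : L2w (rho (beta - 1) (alpha - beta - 1)) f.

Let mu := @lebesgue_measure R.
Let F := \int[mu]_(x in `]0, 1[) (rho (beta - 1) (alpha - beta - 1) x * f x ^+ 2).
Let w := rho (- (alpha - beta)) (- beta).

Let a_gt0 : 0 < alpha - beta.
Proof. by have := alpha1; have := beta1; lra. Qed.

Let b_gt0 : 0 < beta.
Proof. by have := alpha1; have := beta_ge; lra. Qed.

Let Na1 : -1 < alpha - beta. Proof. by have := a_gt0; lra. Qed.

Let Nb1 : -1 < beta. Proof. by have := b_gt0; lra. Qed.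

Let Na1' : -1 < alpha - beta - 1. Proof. by have := a_gt0; lra. Qed.

Let Nb1' : -1 < beta - 1. Proof. by have := b_gt0; lra. Qed.

Let ab_ge1 : 1 <= alpha - beta + beta. Proof. by rewrite subrK ltW. Qed.

(* q_N - c_(-1) x k *)
Definition jacobi_partial_sum (N : nat) (x : R) : R :=
  rho (alpha - beta) beta x *
  \sum_(i < N) ccoef alpha beta f i * jacobiG (alpha - beta) beta i x.

Lemma rho_int_tail_le n m : (n <= m)%N ->
  rho_int (alpha - beta) beta ((\sum_(n <= i < m)
    ccoef alpha beta f i *: jacobi_poly (alpha - beta) beta i) ^+ 2) <=
  `|lambda alpha beta n|^-1 ^+ 2 * F.
Proof.
move=> nm; rewrite rho_int_sum_sqr//.
have Lf i : fcoef alpha beta f i = \int[mu]_(x in `]0, 1[)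
    (rho (beta - 1) (alpha - beta - 1) x * f x *
     (jacobi_poly (beta - 1) (alpha - beta - 1) i).[x]).
  by rewrite /fcoef jacobiGE.
(* The i-th term of Bessel's sum for [f]; since c_i is built from f_(i+1), it is compared with T
   (i+1). *)
pose T i := fcoef alpha beta f i ^+ 2 /
  rho_int (beta - 1) (alpha - beta - 1)
    (jacobi_poly (beta - 1) (alpha - beta - 1) i ^+ 2).
have T0 i : 0 <= T i by rewrite divr_ge0 ?sqr_ge0 ?rho_int_sqr_ge0.
apply: (@le_trans _ _ (\sum_(n <= i < m) `|lambda alpha beta n|^-1 ^+ 2 * T i.+1)).
  rewrite !big_nat; apply: ler_sum => i /andP[ni im].
  apply: (@le_trans _ _ (`|lambda alpha beta i|^-1 ^+ 2 * T i.+1)).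
    rewrite /ccoef jacobiG_norm_sqr /T.
    have := @rho_int_jacobi_sqr_le R (alpha - beta) beta i a_gt0 b_gt0 ab_ge1.
    have := rho_int_sqr_ge0 (alpha - beta) beta (jacobi_poly (alpha - beta) beta i).
    set u := rho_int (alpha - beta) _ _; set v := rho_int (beta - 1) _ _ => u0 uv.
    have -> : `|lambda alpha beta i|^-1 ^+ 2 = (lambda alpha beta i)^-1 ^+ 2.
      by rewrite exprVn real_normK ?num_real// exprVn.
    have vu : v^-1 ^+ 2 * u <= v^-1.
      have [->|v0] := eqVneq v 0; first by rewrite invr0 expr0n mul0r.
      have v0' : 0 < v by rewrite lt_def v0 (le_trans u0 uv).
      by rewrite expr2 -mulrA ler_piMr ?invr_ge0 ?(ltW v0')// ler_pdivrMl// mulr1.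
    rewrite invfM; move: (fcoef _ _ _ _) (lambda _ _ _)^-1 v^-1 vu => p s t tu.
    have -> : (p * (s * t)) ^+ 2 * u = s ^+ 2 * p ^+ 2 * (t ^+ 2 * u) by ring.
    by rewrite [leRHS]mulrA ler_wpM2l// mulr_ge0 ?sqr_ge0.
  apply: ler_wpM2r => //; apply: lerXn2r; rewrite ?nnegrE ?invr_ge0//.
  by apply: lambdaV_le => //; exact: ltW.
rewrite -mulr_sumr ler_wpM2l ?sqr_ge0//.
(* The shifted sum runs over the indices n+1 to m; adding the nonnegative terms T 0, ..., T n
   completes it to a Bessel sum. *)
apply: (@le_trans _ _ (\sum_(0 <= i < m.+1) T i)).
  rewrite big_nat_recl// -[leLHS]add0r lerD//.
  rewrite (big_cat_nat (leq0n n) nm)//= lerDr.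
  by apply: sumr_ge0.
under eq_bigr do rewrite /T Lf.
exact: jacobi_bessel.
Qed.

(** The weight [w] is the inverse of rho^(alpha-beta,beta), so the squared prefactor of the partial
    sums leaves a single power of that weight. *)
Lemma sqr_partial_sum_diff n m x : (n <= m)%N -> 0 < x < 1 ->
  w x * (jacobi_partial_sum m x - jacobi_partial_sum n x) ^+ 2 =
  rho (alpha - beta) beta x * ((\sum_(n <= i < m)
    ccoef alpha beta f i *: jacobi_poly (alpha - beta) beta i) ^+ 2).[x].
Proof.
move=> nm /andP[x0 x1].
have x1' : 0 < 1 - x by rewrite subr_gt0.
rewrite /jacobi_partial_sum -mulrBr.
rewrite -!(big_mkord xpredT (fun i => ccoef alpha beta f i * jacobiG (alpha - beta) beta i x)).
rewrite (big_cat_nat (leq0n n) nm)//= (addrAC (\sum_(0 <= i < n) _)) subrr add0r horner_exp horner_sum.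
under [in RHS]eq_bigr do rewrite hornerZ -jacobiGE.
rewrite exprMn mulrA; congr (_ * _); rewrite /w /rho !powRN expr2.
by field; rewrite !gt_eqF ?powR_gt0.
Qed.

Lemma measurable_partial_sum n : measurable_fun (`]0, 1[ : set R) (jacobi_partial_sum n).
Proof.
apply: measurable_funM; first exact: measurable_rho.
apply: measurable_sum => i; apply: measurable_funM; first exact: measurable_cst.
rewrite jacobiGE; apply: measurable_funTS; apply: continuous_measurable_fun.
exact: continuous_horner.
Qed.

Lemma integral_partial_sum_diff n m : (n <= m)%N ->
  (\int[mu]_(x in `]0%R, 1%R[)
     (w x * (jacobi_partial_sum m x - jacobi_partial_sum n x) ^+ 2)%:E
   <= (`|lambda alpha beta n|^-1 ^+ 2 * F)%:E)%E.
Proof.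
move=> nm; set p := \sum_(n <= i < m) ccoef alpha beta f i *: jacobi_poly (alpha - beta) beta i.
suff -> : (\int[mu]_(x in `]0%R, 1%R[)
     (w x * (jacobi_partial_sum m x - jacobi_partial_sum n x) ^+ 2)%:E
   = (rho_int (alpha - beta) beta (p ^+ 2))%:E)%E.
  by rewrite lee_fin; exact: rho_int_tail_le.
rewrite /rho_int /Rintegral fineK; last first.
  by apply: integrable_fin_num => //; exact: integrable_rho_horner.
apply: eq_integral => x; rewrite inE/= in_itv/= => x01.
by rewrite sqr_partial_sum_diff.
Qed.

Lemma lambdaV_cvg0 : `|lambda alpha beta n|^-1 @[n --> \oo] --> (0 : R).
Proof.
apply: (@squeeze_cvgr _ _ _ _ (cst 0)
   (fun n => `|lambda alpha beta 0|^-1 * n.+1%:R `^ (- alpha + 1))).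
- by apply: nearW => n; rewrite invr_ge0 normr_ge0 lambdaV_bound.
- exact: cvg_cst.
rewrite -[X in _ --> X](mulr0 (`|lambda alpha beta 0|^-1)).
apply: cvgM; first exact: cvg_cst.
have -> : (fun n => n.+1%:R `^ (- alpha + 1) : R) =
    (fun n => (n.+1%:R^-1) `^ (alpha - 1)).
  apply/funext => n; rewrite -powR_inv1// -powRrM.
  by congr (_ `^ _); ring.
have a0 : 0 < alpha - 1 by rewrite subr_gt0.
apply: (cvg_at_rightP _ _ _).1 (powR_cvg0 a0) _ _; split=> //.
exact: cvg_harmonic.
Qed.

Let w0 x : 0 <= w x. Proof. exact: rho_ge0. Qed.

Let w_gt0 x : (`]0, 1[%classic : set R) x -> 0 < w x.
Proof.
by rewrite /= in_itv/= => /andP[x0 x1]; rewrite mulr_gt0// powR_gt0// subr_gt0.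
Qed.

Let mw : measurable_fun (`]0, 1[ : set R) w. Proof. exact: measurable_rho. Qed.

Lemma integral_sqr_fE :
  (\int[mu]_(x in `]0%R, 1%R[) (rho (beta - 1) (alpha - beta - 1) x * f x ^+ 2)%:E
   = F%:E)%E.
Proof.
have [+ _] := @L2wP R (rho (beta - 1) (alpha - beta - 1)) f
  (fun x => rho_ge0 _ _ x) (@measurable_rho R _ _ _).
move=> /(_ f2)[_ fi]; rewrite /F /Rintegral fineK//.
exact: integrable_fin_num.
Qed.

Lemma wnorm_partial_sum_le (l : R -> R) n :
  (\int[mu]_(x in `]0%R, 1%R[) (w x * (l x - jacobi_partial_sum n x) ^+ 2)%:E
    <= (`|lambda alpha beta n|^-1 ^+ 2 * F)%:E)%E ->
  (wnorm w (fun x => l x - jacobi_partial_sum n x)%R <=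
   (1 / `|lambda alpha beta n|)%R%:E *
   wnorm (rho (beta - 1) (alpha - beta - 1)) f)%E.
Proof.
move=> h; apply: wnorm_le => //.
- by move=> x; exact: rho_ge0.
- by rewrite integral_sqr_fE -EFinM div1r.
Qed.

Lemma L2w_partial_sum n : L2w w (jacobi_partial_sum n).
Proof.
split; first exact: measurable_partial_sum.
apply: poweR_lty; apply: le_lt_trans (ltry (`|lambda alpha beta 0|^-1 ^+ 2 * F)).
(* The partial sum of index 0 is empty, so the difference bound from 0 to [n] bounds the partial sum
   itself. *)
apply: le_trans (integral_partial_sum_diff (leq0n n)).
rewrite le_eqVlt; apply/orP; left; apply/eqP; apply: eq_integral => x _.
by rewrite {3}/jacobi_partial_sum big_ord0 mulr0 subr0.
Qed.

Lemma partial_sum_cvg : exists l, L2w_cvg w jacobi_partial_sum l.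
Proof.
have tcvg : `|lambda alpha beta n|^-1 ^+ 2 * F @[n --> \oo] --> (0 : R).
  have := cvgM (cvgM lambdaV_cvg0 lambdaV_cvg0) (cvg_cst F).
  by rewrite !mul0r; exact.
have [l ml hl] := @weighted_L2_complete _ (measurableTypeR R) R mu `]0, 1[%classic w
  (measurable_itv _) mw w_gt0 jacobi_partial_sum _ measurable_partial_sum tcvg
  integral_partial_sum_diff.
exists l; split; first exact: L2w_partial_sum.
  split; first exact: ml.
  apply: poweR_lty; apply: le_lt_trans (ltry (`|lambda alpha beta 0|^-1 ^+ 2 * F)).
  apply: le_trans (hl 0%N).
  rewrite le_eqVlt; apply/orP; left; apply/eqP; apply: eq_integral => x _.
  by rewrite /jacobi_partial_sum big_ord0 mulr0 subr0.
have fin : wnorm (rho (beta - 1) (alpha - beta - 1)) f \is a fin_num.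
  by rewrite ge0_fin_numE ?wnorm_ge0//; case: f2.
apply: (@squeeze_cvge _ _ _ _ (cst 0%E) _ (fun n => (1 / `|lambda alpha beta n|)%R%:E *
   wnorm (rho (beta - 1) (alpha - beta - 1)) f)%E).
- by apply: nearW => n; rewrite wnorm_ge0/= wnorm_partial_sum_le.
- exact: cvg_cst.
- rewrite -(fineK fin); under eq_fun do rewrite -EFinM div1r.
  apply: cvg_EFin; first exact: nearW.
  rewrite -(mul0r (fine (wnorm (rho (beta - 1) (alpha - beta - 1)) f))).
  by apply: cvgM; [exact: lambdaV_cvg0|exact: cvg_cst].
Qed.

(** The bound concerns every limit, not just the one built by completeness; it passes from the
    differences of partial sums to [l] by approximation in norm. *)
Lemma L2w_cvg_partial_sum_le l n : L2w_cvg w jacobi_partial_sum l ->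
  (\int[mu]_(x in `]0%R, 1%R[) (w x * (l x - jacobi_partial_sum n x) ^+ 2)%:E
    <= (`|lambda alpha beta n|^-1 ^+ 2 * F)%:E)%E.
Proof.
move=> [_ [ml _] lcvg].
apply: (@weighted_L2_limit_le _ (measurableTypeR R) R mu `]0, 1[%classic w
  (measurable_itv _) mw w_gt0 l (jacobi_partial_sum n)
  (fun m => jacobi_partial_sum (m + n)%N)) => //.
- exact: measurable_partial_sum.
- by move=> m; exact: measurable_partial_sum.
- by move=> m; apply: integral_partial_sum_diff; exact: leq_addl.
move=> e e0.
have : wnorm w (fun x => l x - jacobi_partial_sum (m + n)%N x) @[m --> \oo] --> 0%E.
  by move: lcvg; rewrite -(cvg_shiftn n).
move=> /fine_cvgP[fin /cvgrPdist_le].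
(* Convergence is known for the norm, while accuracy [e] is wanted for its square. *)
have se : 0 < Num.sqrt e by rewrite sqrtr_gt0.
move=> /(_ _ se) ne.
have [m [fm hm]] := filter_ex (filterI fin ne).
exists m; rewrite -wnorm_sqr// -(fineK fm) poweR_EFin lee_fin.
have f0 : 0 <= fine (wnorm w (fun x => l x - jacobi_partial_sum (m + n)%N x)).
  by rewrite fine_ge0 ?wnorm_ge0.
rewrite powR_mulrn// -(sqr_sqrtr (ltW e0)) lerXn2r ?nnegrE ?sqrtr_ge0//.
by move: hm; rewrite /= sub0r normrN ger0_norm.
Qed.

End series.

(** * Existence of the limit and the two error bounds *)

Theorem theorem3p2 (R : realType) (alpha r beta : R)
    (alpha_gt1 : 1 < alpha) (alpha_lt2 : alpha < 2)
    (r_ge : 2^-1 <= r) (r_le1 : r <= 1)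
    (beta_ge : alpha - 1 <= beta) (beta_le1 : beta <= 1)
    (r_beta : r = sin (pi * beta) /
                  (sin (pi * (alpha - beta)) + sin (pi * beta))) :
  exists2 C : R, 0 < C &
    forall f : R -> R, L2w (rho (beta - 1) (alpha - beta - 1)) f ->
      (exists q : R -> R, is_q alpha beta r f q) /\
      (forall q : R -> R, is_q alpha beta r f q ->
       forall N : nat,
         (wnorm (rho (- (alpha - beta)) (- beta))
            (fun x => q x - qN alpha beta r f N x)%R
          <= (1 / `|lambda alpha beta N|)%R%:E *
             wnorm (rho (beta - 1) (alpha - beta - 1)) f)%E /\
         ((1 / `|lambda alpha beta N|)%R%:E *
             wnorm (rho (beta - 1) (alpha - beta - 1)) f
          <= (C * N.+1%:R `^ (- alpha + 1))%R%:E *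
             wnorm (rho (beta - 1) (alpha - beta - 1)) f)%E).
Proof.
(* At beta = 1 the numerator sin(pi) vanishes, so r = 0, against r >= 1/2. *)
have beta_lt1 : beta < 1.
  rewrite lt_neqAle beta_le1 andbT; apply/eqP => beta1.
  by move: r_beta r_ge; rewrite beta1 mulr1 sinpi mul0r => ->; rewrite lt_geF.
(* The first summand is the constant of [lambdaV_bound]; adding 1 makes positivity immediate. *)
exists (`|lambda alpha beta 0|^-1 + 1); first by rewrite ltr_wpDl ?invr_ge0.
move=> f f2.
have qNE N x : qN alpha beta r f N x - singular_part alpha beta r f x =
    jacobi_partial_sum alpha beta f N x.
  by rewrite /qN addrC addKr.
have is_qE q : is_q alpha beta r f q <->
    L2w_cvg (rho (- (alpha - beta)) (- beta)) (jacobi_partial_sum alpha beta f)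
      (fun x => q x - singular_part alpha beta r f x).
  rewrite /is_q; rewrite (_ : (fun N x => _) = jacobi_partial_sum alpha beta f)//.
  by apply/funext => N; apply/funext => x; exact: qNE.
split.
  have [l lP] := partial_sum_cvg alpha_gt1 alpha_lt2 beta_ge beta_lt1 f2.
  exists (fun x => l x + singular_part alpha beta r f x); apply/is_qE.
  rewrite (_ : (fun x => _) = l)//.
  by apply/funext => x; rewrite addrK.
move=> q /is_qE qP N; split.
  have := L2w_cvg_partial_sum_le alpha_gt1 beta_ge beta_lt1 f2 N qP.
  move=> /(wnorm_partial_sum_le f2).
  (* The singular part occurs in both [q] and [qN] and cancels in the difference. *)
  rewrite (_ : (fun x => _ - _) = (fun x => q x - qN alpha beta r f N x)).
    exact.
  by apply/funext => x; rewrite -qNE opprB addrA subrK.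
apply: lee_wpmul2r; first exact: wnorm_ge0.
rewrite lee_fin div1r (le_trans (lambdaV_bound _ _ alpha_gt1 alpha_lt2))//.
by rewrite ler_wpM2r ?powR_ge0// lerDl.
Qed.
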